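(* Let $E$ be a real Banach lattice with order continuous norm. Let $\mathscr{T}=(T(t))_{t\in [0,\infty)}$ be a positive, irreducible and Abel bounded strongly continuous semigroup on $E$ with generator $A$. If $T(t_0)$ is a Harris operator for some $t_0>0$, then $\sigma_p(A_{\mathbb{C}}) \cap i\mathbb{R} \subseteq \{ 0\}$.
   Context: Let $E$ be a real Banach lattice with order continuous norm and $\mathbb{N}=\{1,2,\dots\}$. A strongly continuous semigroup is a family $(T(t))_{t\in[0,\infty)}$ of bounded linear operators on $E$ with $T(0)=I$, $T(t+s)=T(t)T(s)$ for all $t,s\geq 0$, and $t\mapsto T(t)x$ continuous for every $x\in E$. It is positive if every $T(t)$ is positive. It is irreducible if the only closed (lattice) ideals $J\subseteq E$ with $T(t)J\subseteq J$ for all $t$ are $\{0\}$ and $E$. $E_{\mathbb{C}}$ denotes the complexification of $E$, and $A_{\mathbb{C}}$ the complexification of $A$, which is the generator of $(T(t)_{\mathbb{C}})_{t\ge0}$ on $E_{\mathbb{C}}$. $\sigma$ denotes the spectrum and $\sigma_p$ the point spectrum (set of eigenvalues). The semigroup with generator $A$ is Abel bounded if $\mathrm{Re}\,\lambda\le 0$ for all $\lambda\in\sigma(A_{\mathbb{C}})$ and $\sup_{\lambda>0}\|\lambda(\lambda-A_{\mathbb{C}})^{-1}\|<\infty$. A linear operator on $E$ is regular if it is the difference of two positive operators; the regular operators on $E$ form an order complete vector lattice. $E'\otimes E$ denotes the space of finite rank operators on $E$, and $(E'\otimes E)^{\perp}$ its disjoint complement in the lattice of regular operators. A regular operator $T$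 is a Harris operator if $T^n\notin (E'\otimes E)^{\perp}$ for some $n\in\mathbb{N}$. *)

(* Defs.v *)
From HB Require Import structures.
From mathcomp Require Import all_boot all_order all_algebra.
From mathcomp Require Import complex.
From mathcomp Require Import all_classical all_reals all_analysis.

Set Implicit Arguments.
Unset Strict Implicit.
Unset Printing Implicit Defensive.

Import Order.TTheory GRing.Theory Num.Theory numFieldNormedType.Exports.

Local Open Scope classical_set_scope.
Local Open Scope ring_scope.
Local Open Scope complex_scope.

Section order_bounds.
Context {T : Type}.
Implicit Types (le : T -> T -> Prop) (D A : set T).

(* [m] is the supremum (infimum) of [A] formed inside [D]. *)
Definition is_lub le D A (m : T) :=
  [/\ D m, forall x, A x -> le x m
    & forall u, D u -> (forall x, A x -> le x u) -> le m u].

Definition is_glb le D A (m : T) := is_lub (fun x y => le y x) D A m.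

End order_bounds.

(* The order is a field of the mixin because MathComp's hierarchy has no join
   of its ordered structures with the normed modules. *)
HB.mixin Record isBanachLattice (R : realType) E
    of CompleteNormedModule R E := {
  vle : E -> E -> Prop ;
  vjoin : E -> E -> E ;
  vmeet : E -> E -> E ;
  vle_refl : forall x, vle x x ;
  vle_anti : forall x y, vle x y -> vle y x -> x = y ;
  vle_trans : forall y x z, vle x y -> vle y z -> vle x z ;
  vjoinP : forall x y z, vle (vjoin x y) z <-> vle x z /\ vle y z ;
  vmeetP : forall x y z, vle z (vmeet x y) <-> vle z x /\ vle z y ;
  vle_add2l : forall z x y, vle x y -> vle (z + x) (z + y) ;
  vle_scale : forall (a : R) x, 0 <= a -> vle 0 x -> vle 0 (a *: x) ;
  vle_norm : forall x y,
    vle (vjoin x (- x)) (vjoin y (- y)) -> `|x| <= `|y|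
}.

#[short(type="banachLatticeType")]
HB.structure Definition BanachLattice (R : realType) :=
  { E of isBanachLattice R E & CompleteNormedModule R E }.

Notation "x <=v y" := (vle x y) (at level 70, y at next level) : ring_scope.

Definition vabs (R : realType) (E : banachLatticeType R) (x : E) : E :=
  vjoin x (- x).

(* Nets decreasing to 0 are represented by downward directed sets with
   infimum 0. *)
Definition order_continuous_norm (R : realType) (E : banachLatticeType R) :=
  forall D : set E, D !=set0 ->
    (forall x y, D x -> D y -> exists z, [/\ D z, z <=v x & z <=v y]) ->
    is_glb vle setT D 0 ->
    forall e : R, 0 < e ->
      exists2 x0, D x0 & forall x, D x -> x <=v x0 -> `|x| < e.

Section operators.
Context {R : realType} {E : banachLatticeType R}.
Implicit Types (S T : E -> E).

Definition positive_op T := forall x, 0 <=v x -> 0 <=v T x.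

Definition regular_op T := exists P Q : {linear E -> E},
  [/\ positive_op P, positive_op Q & forall x, T x = P x - Q x].

Definition op_le S T := forall x, 0 <=v x -> S x <=v T x.

Definition op_modulus T M :=
  is_lub op_le regular_op [set T; (fun x => - T x)] M.

Definition op_disjoint S T := exists M N,
  [/\ op_modulus S M, op_modulus T N
    & is_glb op_le regular_op [set M; N] (fun=> 0)].

Definition disjoint_complement (F : set (E -> E)) : set (E -> E) :=
  [set T | regular_op T /\ forall K, F K -> op_disjoint T K].

(* E' (x) E *)
Definition finite_rank : set (E -> E) :=
  [set K | exists n (phi : 'I_n -> {scalar E}) (u : 'I_n -> E),
     (forall i, continuous (phi i : E -> R)) /\
     forall x, K x = \sum_(i < n) phi i x *: u i].

Definition harris T := regular_op T /\
  exists2 n : nat, (0 < n)%N & ~ disjoint_complement finite_rank (iter n T).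

Definition lattice_ideal (J : set E) :=
  [/\ J 0, forall x y, J x -> J y -> J (x + y),
      forall (a : R) x, J x -> J (a *: x)
    & forall x y, J y -> vabs x <=v vabs y -> J x].

End operators.

(* Only the values at times t >= 0 matter. *)
Section semigroups.
Context {R : realType} {E : banachLatticeType R}.
Variable T : R -> {linear E -> E}.

Definition C0_semigroup :=
  [/\ forall t, 0 <= t -> continuous (T t),
      forall x, T 0 x = x,
      forall t s x, 0 <= t -> 0 <= s -> T (t + s) x = T t (T s x)
    & forall x, {within [set t : R | 0 <= t], continuous (fun t => T t x)}].

Definition positive_semigroup := forall t, 0 <= t -> positive_op (T t).

Definition irreducible_semigroup := forall J : set E,
  closed J -> lattice_ideal J ->
  (forall t, 0 <= t -> forall x, J x -> J (T t x)) ->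
  J = [set 0] \/ J = setT.

End semigroups.

(* A partially defined operator; its values outside [dom] are irrelevant. *)
Record partial_op (V : Type) := PartialOp { dom : set V ; op :> V -> V }.

Definition generator (R : realType) (E : banachLatticeType R)
    (T : R -> {linear E -> E}) : partial_op E :=
  let quotient x := (fun t : R => t^-1 *: (T t x - x)) @ (0 : R)^'+ in
  PartialOp [set x | cvg (quotient x)] (fun x => lim (quotient x)).

Section complexification.
Context {R : realType}.

(* The pair (x, y) stands for x + iy. *)
Definition complexification (E : lmodType R) : Type := (E * E)%type.

Variable E : lmodType R.
HB.instance Definition _ := GRing.Zmodule.copy (complexification E) (E * E)%type.

Definition cscale (l : R[i]) (z : complexification E) : complexification E :=
  (complex.Re l *: z.1 - complex.Im l *: z.2,
   complex.Re l *: z.2 + complex.Im l *: z.1).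

Fact cscaleA l m z : cscale l (cscale m z) = cscale (l * m) z.
Proof.
case: l m z => a b [c d] [x y]; rewrite /cscale /=; apply: (f_equal2 pair) => /=.
- rewrite !(scalerBr, scalerDr, scalerBl, scalerDl, scalerA) !opprD.
  by rewrite -!addrA; congr (_ + _); rewrite [LHS]addrA [LHS]addrC.
- rewrite scalerDr scalerBr scalerBl scalerDl !scalerA.
  by rewrite -!addrA; congr (_ + _); rewrite [LHS]addrA [LHS]addrC.
Qed.

Fact cscale1 : left_id 1 cscale.
Proof.
by case=> x y; rewrite /cscale /= !scale1r !scale0r subr0 addr0.
Qed.

Fact cscaleDr : right_distributive cscale +%R.
Proof.
move=> l [x y] [x' y']; rewrite /cscale /=; apply: (f_equal2 pair) => /=.
- by rewrite !scalerDr opprD addrACA.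
- by rewrite !scalerDr addrACA.
Qed.

Fact cscaleDl z : {morph cscale^~ z : l m / l + m}.
Proof.
case: z => x y [a b] [c d]; rewrite /cscale /=; apply: (f_equal2 pair) => /=.
- by rewrite !scalerDl opprD addrACA.
- by rewrite !scalerDl addrACA.
Qed.

HB.instance Definition _ := GRing.Zmodule_isLmodule.Build R[i]
  (complexification E) cscaleA cscale1 cscaleDr cscaleDl.

End complexification.

Section complexified_operators.
Context {R : realType} {E : banachLatticeType R}.
Local Notation EC := (complexification E).
Implicit Types (A : partial_op EC) (l : R[i]).

(* |x + iy| = sup_t (cos t x + sin t y); this supremum exists in every Banach
   lattice, so the default value 0 is never used. *)
Definition cmodulus (z : EC) : E :=
  xget 0 (is_lub vle setT [set cos t *: z.1 + sin t *: z.2 | t in [set: R]]).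

Definition cnorm (z : EC) : R := `|cmodulus z|.

Definition complexify (A : partial_op E) : partial_op EC :=
  PartialOp [set z | dom A z.1 /\ dom A z.2] (fun z => (A z.1, A z.2)).

(* S = (l - A)^-1 as a bounded operator on E_C *)
Definition is_resolvent A l (S : {linear EC -> EC}) :=
  [/\ exists M : R, forall z, cnorm (S z) <= M * cnorm z,
      forall z, dom A (S z) /\ l *: S z - A (S z) = z
    & forall z, dom A z -> S (l *: z - A z) = z].

Definition spectrum A : set R[i] := [set l | ~ exists S, is_resolvent A l S].

Definition point_spectrum A : set R[i] :=
  [set l | exists z : EC, [/\ dom A z, z != 0 & A z = l *: z]].

Definition Abel_bounded A :=
  (forall l, spectrum A l -> complex.Re l <= 0) /\
  exists M : R, forall l : R, 0 < l -> exists2 S, is_resolvent A l%:C S &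
    forall z, cnorm (l%:C *: S z) <= M * cnorm z.

End complexified_operators.

(* Main.v *)
From HB Require Import structures.
Require Import Defs.
From mathcomp Require Import all_boot all_order all_algebra.
From mathcomp Require Import complex ring lra.
From mathcomp Require Import all_classical all_reals all_analysis.

(** Suppose [i al] is an eigenvalue with [al != 0] and eigenvector [a + i b].
    Then no operator of the semigroup, at any time [s >= 0], can be
    anything but disjoint from all finite rank operators; since the powers of
    [T t0] are operators of the semigroup, [T t0] is not a Harris operator.

    The eigenvector unfolds into the circle of real vectors
    [phase t = cos t a + sin t b], which [T s] rotates by the angle [- al s]
    ([orbit_phase]).  Their supremum [e], the modulus of the eigenvector,
    satisfies [e <= T s e].  Abel boundedness makes the operators
    [l (l - A)^-1], [l -> 0+], an ergodic net: these are positive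
    ([resolvent_positive]), they do not decrease [e]
    ([resolvent_superharmonic]), and a Hahn-Banach limit of them yields a
    positive functional [f] with [f (T s x) <= f x] for [x >= 0] and [0 < f e]
    ([subinvariant_functional]).  By irreducibility [f] is strictly positive
    and [e] is quasi-interior, whence [T s e = e].

    Cut the circle into [2 n] arcs and let [hump t] be a multiple of the
    positive part of [phase t - cos (pi / n) e]: it is carried by an arc around
    [t].  The humps at the [2 n] division points dominate [e] ([hump_cover]),
    and every second one of them form a disjoint family ([hump_disjoint]).
    Strict positivity of [f] forces [T s] to map humps to humps
    ([orbit_hump]), and all humps have the same value under [f].  As [n]
    disjoint humps fit under [2 e], this value is at most [f (2 e) / n].  The
    norm being order continuous, [f] controls the norm on order intervals
    ([functional_controls_norm]), so the humps are uniformly small in norm: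
    the circle carries no atoms.

    A modulus [N] of a finite rank operator satisfies [N x <= C |x| u].  If a
    regular operator [L] lies below [T s] and [N], decompose [0 <= x <= m e]
    into pieces [z] under the humps.  Then [L z] lies below the image of a hump,
    which is a hump again, and below [C |z| u] with [|z|] small.
    Since disjoint elements have the same sum and supremum, the sum over the
    pieces is at most [2 C m eps u].  Hence [L x <= 0], first for these [x] and
    then for all [x >= 0] because [e] is quasi-interior
    ([minorant_le0]). *)

Set Implicit Arguments.
Unset Strict Implicit.
Unset Printing Implicit Defensive.

Import Order.TTheory GRing.Theory Num.Theory numFieldNormedType.Exports.

Local Open Scope classical_set_scope.
Local Open Scope ring_scope.

(** * Vector lattice arithmetic *)

Arguments vle_trans {R s y x z}.
Arguments vle_anti {R s x y}.
Arguments vle_add2l {R s} z {x y}.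
Arguments vle_scale {R s a x}.

Lemma subr_eq_subr (V : zmodType) (a b c d : V) :
  (a - b == c - d) = (a + d == c + b).
Proof. by rewrite subr_eq addrAC eq_sym subr_eq eq_sym. Qed.

Definition vpos (R : realType) (E : banachLatticeType R) (x : E) : E :=
  vjoin x 0.

Section vector_lattice.
Context {R : realType} {E : banachLatticeType R}.
Implicit Types (x y z u v w : E) (a b c : R).

Lemma vle_add2r z x y : x <=v y -> x + z <=v y + z.
Proof. by move=> xy; rewrite ![_ + z]addrC; exact: vle_add2l. Qed.

Lemma vleD x y u v : x <=v y -> u <=v v -> x + u <=v y + v.
Proof.
by move=> xy uv; apply: (vle_trans (vle_add2r u xy)); exact: vle_add2l.
Qed.

Lemma vsub_ge0 x y : 0 <=v y - x <-> x <=v y.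
Proof.
split=> h; first by have := vle_add2r x h; rewrite add0r subrK.
by have := vle_add2r (- x) h; rewrite subrr.
Qed.

Lemma vleN2 x y : x <=v y -> - y <=v - x.
Proof. by move=> /vsub_ge0 h; apply/vsub_ge0; rewrite opprK addrC. Qed.

Lemma voppr_le0 x : 0 <=v x -> - x <=v 0.
Proof. by move=> x0; rewrite -oppr0; exact: vleN2. Qed.

Lemma vleBlD x y z : x - y <=v z <-> x <=v z + y.
Proof.
by split=> h; [have := vle_add2r y h; rewrite subrK|
  have := vle_add2r (- y) h; rewrite addrK].
Qed.

Lemma vleBrD x y z : x <=v z - y <-> x + y <=v z.
Proof.
by split=> h; [have := vle_add2r y h; rewrite subrK|
  have := vle_add2r (- y) h; rewrite addrK].
Qed.

Lemma vaddr_ge0 x y : 0 <=v x -> 0 <=v y -> 0 <=v x + y.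
Proof. by move=> x0 y0; rewrite -[0]addr0; exact: vleD. Qed.

Lemma vle_addr x y : 0 <=v y -> x <=v x + y.
Proof. by move=> y0; rewrite -{1}[x]addr0; exact: vle_add2l. Qed.

Lemma vle_addl x y : 0 <=v y -> x <=v y + x.
Proof. by move=> y0; rewrite addrC; exact: vle_addr. Qed.

Lemma vle_subl x y : 0 <=v y -> x - y <=v x.
Proof. by move=> y0; apply/vleBlD; exact: vle_addr. Qed.

Lemma vleZ a x y : 0 <= a -> x <=v y -> a *: x <=v a *: y.
Proof.
by move=> a0 /vsub_ge0 h; apply/vsub_ge0; rewrite -scalerBr; exact: vle_scale.
Qed.

Lemma vleZr a b x : a <= b -> 0 <=v x -> a *: x <=v b *: x.
Proof.
move=> ab x0; apply/vsub_ge0; rewrite -scalerBl.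
by apply: vle_scale => //; rewrite subr_ge0.
Qed.

Lemma vleZK a x y : 0 < a -> a *: x <=v a *: y -> x <=v y.
Proof.
move=> a0 /(vleZ (ltW (_ : 0 < a^-1))).
by rewrite !scalerA mulVf ?gt_eqF// !scale1r; apply; rewrite invr_gt0.
Qed.

Lemma vsum_ge0 (I : Type) (r : seq I) (F : I -> E) :
  (forall i, 0 <=v F i) -> 0 <=v \sum_(i <- r) F i.
Proof.
move=> F0; elim/big_ind: _ => //; [exact: vle_refl|exact: vaddr_ge0].
Qed.

Lemma vle_sum (I : Type) (r : seq I) (F G : I -> E) :
  (forall i, F i <=v G i) -> \sum_(i <- r) F i <=v \sum_(i <- r) G i.
Proof.
move=> F0; elim/big_ind2: _ => //; [exact: vle_refl|move=> *; exact: vleD].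
Qed.

Lemma vle_joinl x y : x <=v vjoin x y.
Proof. by have [/(_ (vle_refl _)) []] := vjoinP x y (vjoin x y). Qed.

Lemma vle_joinr x y : y <=v vjoin x y.
Proof. by have [/(_ (vle_refl _)) []] := vjoinP x y (vjoin x y). Qed.

Lemma vjoin_le x y z : x <=v z -> y <=v z -> vjoin x y <=v z.
Proof. by move=> ? ?; apply/vjoinP. Qed.

Lemma vmeet_lel x y : vmeet x y <=v x.
Proof. by have [/(_ (vle_refl _)) []] := vmeetP x y (vmeet x y). Qed.

Lemma vmeet_ler x y : vmeet x y <=v y.
Proof. by have [/(_ (vle_refl _)) []] := vmeetP x y (vmeet x y). Qed.

Lemma vmeet_ge x y z : z <=v x -> z <=v y -> z <=v vmeet x y.
Proof. by move=> ? ?; apply/vmeetP. Qed.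

Lemma vmeet_mono x y u v : x <=v u -> y <=v v -> vmeet x y <=v vmeet u v.
Proof.
move=> xu yv; apply: vmeet_ge.
- exact: (vle_trans (vmeet_lel x y)).
- exact: (vle_trans (vmeet_ler x y)).
Qed.

Lemma vjoinDmeet x y : vjoin x y + vmeet x y = x + y.
Proof.
apply: vle_anti.
- apply/vleBrD; apply: vjoin_le; apply/vleBrD.
  + by apply: vle_add2l; exact: vmeet_ler.
  + by rewrite addrC; apply: vle_add2r; exact: vmeet_lel.
- rewrite [vjoin _ _ + _]addrC; apply/vleBlD; apply: vmeet_ge; apply/vleBlD.
  + by apply: vle_add2l; exact: vle_joinr.
  + by rewrite addrC; apply: vle_add2l; exact: vle_joinl.
Qed.

Lemma vpos_ge0 x : 0 <=v vpos x. Proof. exact: vle_joinr. Qed.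

Lemma vle_pos x : x <=v vpos x. Proof. exact: vle_joinl. Qed.

Lemma vpos_le x y : x <=v y -> 0 <=v y -> vpos x <=v y.
Proof. exact: vjoin_le. Qed.

Lemma vpos_mono x y : x <=v y -> vpos x <=v vpos y.
Proof.
move=> xy; apply: vpos_le; last exact: vpos_ge0.
by apply: (vle_trans xy); exact: vle_pos.
Qed.

Lemma vpos_id x : 0 <=v x -> vpos x = x.
Proof.
move=> x0; apply: vle_anti; last exact: vle_pos.
by apply: vpos_le => //; exact: vle_refl.
Qed.

Lemma vpos_eq0 x : x <=v 0 -> vpos x = 0.
Proof.
move=> x0; apply: vle_anti; last exact: vpos_ge0.
by apply: vpos_le => //; exact: vle_refl.
Qed.

Lemma vposD x y : vpos (x + y) <=v vpos x + vpos y.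
Proof.
apply: vpos_le; first by apply: vleD; exact: vle_pos.
by apply: vaddr_ge0; exact: vpos_ge0.
Qed.

Lemma vposZ a x : 0 <= a -> vpos (a *: x) = a *: vpos x.
Proof.
rewrite le_eqVlt => /predU1P[<-|a0].
  by rewrite !scale0r vpos_id//; exact: vle_refl.
apply: vle_anti.
- apply: vpos_le; first by apply: vleZ; [exact: ltW|exact: vle_pos].
  by apply: vle_scale; [exact: ltW|exact: vpos_ge0].
- have a1 : 0 < a^-1 by rewrite invr_gt0.
  apply: (vleZK a1); rewrite scalerA mulVf ?gt_eqF// scale1r.
  apply: vpos_le; last by apply: vle_scale; [exact: ltW|exact: vpos_ge0].
  rewrite -{1}[x]scale1r -(@mulVf _ a) ?gt_eqF// -scalerA.
  by apply: vleZ; [exact: ltW|exact: vle_pos].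
Qed.

Lemma vposBneg x : vpos x - vpos (- x) = x.
Proof.
apply/eqP; rewrite subr_eq; apply/eqP; apply: vle_anti.
- apply: vpos_le.
  + by apply: vle_addr; exact: vpos_ge0.
  + by have := vle_add2l x (vle_pos (- x)); rewrite subrr.
- rewrite addrC; apply/vleBrD; apply: vpos_le.
  + rewrite -[X in X <=v _]add0r; apply: vle_add2r; exact: vpos_ge0.
  + by apply/vsub_ge0; exact: vle_pos.
Qed.

Lemma vabs_ge x : x <=v vabs x. Proof. exact: vle_joinl. Qed.

Lemma vabs_geN x : - x <=v vabs x. Proof. exact: vle_joinr. Qed.

Lemma vabs_le x y : x <=v y -> - x <=v y -> vabs x <=v y.
Proof. exact: vjoin_le. Qed.

Lemma vabs_leP x y : vabs x <=v y -> - y <=v x /\ x <=v y.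
Proof.
move=> xy; split; last exact: (vle_trans (vabs_ge x)).
by rewrite -[x]opprK; apply: vleN2; exact: (vle_trans (vabs_geN x)).
Qed.

Lemma vabs_ge0 x : 0 <=v vabs x.
Proof.
have h2 : (0 : R) < 2 by [].
apply: (vleZK h2); rewrite scaler0 (scaler_nat 2) mulr2n -(subrr x).
by apply: vleD; [exact: vabs_ge|exact: vabs_geN].
Qed.

Lemma vabs_id x : 0 <=v x -> vabs x = x.
Proof.
move=> x0; apply: vle_anti; last exact: vabs_ge.
apply: vabs_le; first exact: vle_refl.
by apply: (vle_trans (voppr_le0 x0)).
Qed.

Lemma vabsN x : vabs (- x) = vabs x.
Proof.
have h y : vabs (- y) <=v vabs y.
  by apply: vabs_le; rewrite ?opprK; [exact: vabs_geN|exact: vabs_ge].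
by apply: vle_anti => //; rewrite -{1}[x]opprK.
Qed.

Lemma vabsD x y : vabs (x + y) <=v vabs x + vabs y.
Proof.
apply: vabs_le; first by apply: vleD; exact: vabs_ge.
by rewrite opprD; apply: vleD; exact: vabs_geN.
Qed.

Lemma vabsZ_le a x : vabs (a *: x) <=v `|a| *: vabs x.
Proof.
have h b : b *: x <=v `|b| *: vabs x.
  have [b0|b0] := leP 0 b.
    by rewrite ger0_norm//; apply: vleZ => //; exact: vabs_ge.
  rewrite ltr0_norm// -[b *: x]opprK -scaleNr -scalerN.
  by apply: vleZ; [rewrite oppr_ge0 ltW|exact: vabs_geN].
by apply: vabs_le => //; rewrite -scaleNr -normrN.
Qed.

Lemma vpos_le_abs x : vpos x <=v vabs x.
Proof. by apply: vpos_le; [exact: vabs_ge|exact: vabs_ge0]. Qed.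

Lemma vpos_split x : vpos x + vpos (- x) = vabs x.
Proof.
apply: vle_anti.
- have -> : vpos x + vpos (- x) = x + (vpos (- x) + vpos (- x)).
    by rewrite addrA; congr (_ + _); rewrite -{2}(vposBneg x) subrK.
  rewrite -[vpos (- x) + vpos (-x)]mulr2n -scaler_nat -vposZ//.
  rewrite addrC; apply/vleBrD; apply: vpos_le.
  + rewrite scaler_nat mulr2n; apply: vle_add2r; exact: vabs_geN.
  + by apply/vsub_ge0; exact: vabs_ge.
- apply: vabs_le.
  + rewrite -{1}(vposBneg x); apply: vle_add2l.
    by apply: (vle_trans (voppr_le0 (vpos_ge0 _))); exact: vpos_ge0.
  + rewrite -{1}(vposBneg x) opprB addrC; apply: vle_add2r.
    by apply: (vle_trans (voppr_le0 (vpos_ge0 _))); exact: vpos_ge0.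
Qed.

Lemma vnorm_mono x y : 0 <=v x -> x <=v y -> `|x| <= `|y|.
Proof.
move=> x0 xy; apply: vle_norm; rewrite -/(vabs x) -/(vabs y) !vabs_id//.
exact: (vle_trans x0).
Qed.

Lemma vnorm_abs x : `|vabs x| = `|x|.
Proof.
have h : vabs (vabs x) = vabs x by rewrite vabs_id//; exact: vabs_ge0.
by apply/eqP; rewrite eq_le; apply/andP; split; apply: vle_norm;
  rewrite -/(vabs x) -/(vabs (vabs x)) h; exact: vle_refl.
Qed.

Lemma vnorm_pos x : `|vpos x| <= `|x|.
Proof.
rewrite -(vnorm_abs x); apply: vnorm_mono; first exact: vpos_ge0.
exact: vpos_le_abs.
Qed.

Lemma vnorm_le_abs x y : vabs x <=v y -> `|x| <= `|y|.
Proof.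
by rewrite -(vnorm_abs x) => ?; apply: vnorm_mono => //; exact: vabs_ge0.
Qed.

(** The order is closed: an inequality may be proved up to an error of
    arbitrarily small norm. *)
Lemma vle_eps x y :
  (forall e : R, 0 < e -> exists2 r, x <=v y + r & `|r| <= e) -> x <=v y.
Proof.
move=> h; have p0 : vpos (x - y) = 0.
  apply/eqP; rewrite -normr_le0; apply/ler_addgt0Pl => e e0; rewrite addr0.
  have [r xr re] := h e e0; apply: le_trans re.
  apply: le_trans (vnorm_pos r); apply: vnorm_mono; first exact: vpos_ge0.
  by apply: vpos_mono; apply/vleBlD; rewrite addrC.
by apply/vsub_ge0; rewrite -opprB -oppr0; apply: vleN2;
  rewrite -p0; exact: vle_pos.
Qed.

(** The Archimedean property, with the norm of [y / n] as the error. *)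
Lemma vle_archi x y : (forall n : nat, n%:R *: x <=v y) -> x <=v 0.
Proof.
move=> h; apply: vle_eps => e e0.
pose n := (Num.truncn (`|y| / e)).+1.
have n0 : 0 < n%:R :> R by [].
exists (n%:R^-1 *: y).
  rewrite add0r; have := vleZ (_ : 0 <= n%:R^-1) (h n).
  by rewrite scalerA mulVf ?gt_eqF// scale1r; apply; rewrite invr_ge0 ltW.
rewrite normrZ ger0_norm ?invr_ge0 ?(ltW n0)// mulrC ler_pdivrMr//.
by rewrite mulrC -ler_pdivrMr// ltW// /n truncnS_gt.
Qed.

End vector_lattice.

Section decompositions.
Context {R : realType} {E : banachLatticeType R}.
Implicit Types (x y z u v w : E) (a b c : R).

Lemma vmeet_ge0 x y : 0 <=v x -> 0 <=v y -> 0 <=v vmeet x y.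
Proof. exact: vmeet_ge. Qed.

Lemma vmeetDl x y z : 0 <=v x -> 0 <=v y -> 0 <=v z ->
  vmeet (x + y) z <=v vmeet x z + vmeet y z.
Proof.
move=> x0 y0 z0; apply/vleBlD; apply: vmeet_ge.
  apply/vleBlD; rewrite [x + _ in X in _ <=v X]addrC; apply/vleBlD.
  apply: vmeet_ge; first by apply/vleBlD; rewrite [y + x]addrC; exact: vmeet_lel.
  by apply: (vle_trans (vle_subl _ x0)); exact: vmeet_ler.
apply: (vle_trans (vle_subl _ (vmeet_ge0 y0 z0))); exact: vmeet_ler.
Qed.

Lemma vmeetZ_eq0 a x y : 0 <= a -> 0 <=v x -> 0 <=v y ->
  vmeet x y = 0 -> vmeet (a *: x) (a *: y) = 0.
Proof.
rewrite le_eqVlt => /predU1P[<-|a0] x0 y0 xy.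
  rewrite !scale0r; apply: vle_anti; first exact: vmeet_lel.
  by apply: vmeet_ge; exact: vle_refl.
apply: vle_anti; last by apply: vmeet_ge0; apply: vle_scale => //; exact: ltW.
have a1 : 0 < a^-1 by rewrite invr_gt0.
apply: (vleZK a1); rewrite scaler0 -xy; apply: vmeet_ge.
  rewrite -[X in _ <=v X]scale1r -(@mulVf _ a) ?gt_eqF// -scalerA.
  by apply: vleZ; [exact: ltW|exact: vmeet_lel].
rewrite -[X in _ <=v X]scale1r -(@mulVf _ a) ?gt_eqF// -scalerA.
by apply: vleZ; [exact: ltW|exact: vmeet_ler].
Qed.

Lemma vpos_disjoint x : vmeet (vpos x) (vpos (- x)) = 0.
Proof.
apply: vle_anti; last by apply: vmeet_ge; exact: vpos_ge0.
set w := vmeet _ _; have w1 : w <=v vpos x := vmeet_lel _ _.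
have w2 : w <=v vpos (- x) := vmeet_ler _ _.
have : vpos x <=v vpos x - w.
  apply: vpos_le; last exact/vsub_ge0.
  have xE : vpos x = x + vpos (- x) by rewrite -{2}(vposBneg x) subrK.
  by apply/vleBrD; rewrite xE; exact: vle_add2l.
by move=> /vsub_ge0; rewrite addrC addKr => /voppr_le0; rewrite opprK.
Qed.

(** Disjoint elements have the same sum and supremum. *)
Lemma disjoint_sum_le n (y : nat -> E) v : 0 <=v v ->
  (forall i, (i < n)%N -> 0 <=v y i /\ y i <=v v) ->
  (forall i j, (i < j < n)%N -> vmeet (y i) (y j) = 0) ->
  \sum_(i < n) y i <=v v.
Proof.
move=> v0; elim: n => [|n IH] yv disj; first by rewrite big_ord0.
rewrite big_ord_recr/= -vjoinDmeet.
set s := \sum_(i < n) _; have yn0 := (yv n (ltnSn n)).1.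
have sv : s <=v v.
  apply: IH => [i ni|i j /andP[ij jn]]; first by apply: yv; rewrite ltnW.
  by apply: disj; rewrite ij ltnW.
suff sy : vmeet s (y n) <=v 0.
  rewrite -[v]addr0; apply: vleD sy.
  by apply: vjoin_le => //; exact: (yv n (ltnSn n)).2.
suff : forall m, (m <= n)%N -> 0 <=v \sum_(i < m) y i /\
    vmeet (\sum_(i < m) y i) (y n) <=v 0 by move=> /(_ n (leqnn n)) [].
elim=> [|m IHm] mn.
  by rewrite big_ord0; split; [exact: vle_refl|exact: vmeet_lel].
have [s0 sm] := IHm (ltnW mn).
have ym0 := (yv m (ltnW mn)).1.
rewrite big_ord_recr/=; split; first exact: vaddr_ge0.
apply: (vle_trans (vmeetDl s0 ym0 yn0)); rewrite -[X in _ <=v X]addr0; apply: vleD => //.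
by rewrite disj ?mn ?ltnSn//; exact: vle_refl.
Qed.

(** The part of [x] that does not fit under [y] is [(x - y)^+], and it fits
    under [z]. *)
Lemma riesz_decomposition x y z : 0 <=v x -> 0 <=v y -> 0 <=v z ->
  x <=v y + z -> exists x1 x2,
  [/\ x = x1 + x2, 0 <=v x1 /\ x1 <=v y & 0 <=v x2 /\ x2 <=v z].
Proof.
move=> x0 y0 z0 xyz; exists (x - vpos (x - y)), (vpos (x - y)).
rewrite subrK; split=> //; split.
- apply/vsub_ge0; apply: vpos_le => //; exact: vle_subl.
- by apply/vleBlD; rewrite addrC; apply/vleBlD; exact: vle_pos.
- exact: vpos_ge0.
- by apply: vpos_le => //; apply/vleBlD; rewrite addrC.
Qed.

Lemma riesz_decomposition_sum n x (y : nat -> E) : 0 <=v x ->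
  (forall i, 0 <=v y i) -> x <=v \sum_(i < n) y i ->
  exists2 z : nat -> E, forall i, 0 <=v z i /\ z i <=v y i &
    x = \sum_(i < n) z i.
Proof.
move=> + y0; elim: n x => [|n IH] x x0.
  rewrite big_ord0 => x_le0; exists (fun=> 0).
    by move=> i; split=> //; exact: vle_refl.
  by rewrite big_ord0; exact: vle_anti.
rewrite big_ord_recr/= => /(riesz_decomposition x0 (vsum_ge0 _ _)).
move=> /(_ (fun i => y0 i) (y0 n)) [x1 [x2 [xE [x10 x1y] x2y]]].
have [z zy x1E] := IH _ x10 x1y.
exists (fun i => if i == n then x2 else z i).
  by move=> i; case: eqP => [->//|_]; exact: zy.
rewrite big_ord_recr/= eqxx xE x1E; congr (_ + _).
by apply: eq_bigr => i _; rewrite ltn_eqF.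
Qed.

End decompositions.

Section additive_on_cone.
Context {R : realType} {E : banachLatticeType R}.
Implicit Types (x y z : E).

(** The extension is [x |-> f x^+ - f x^-]; additivity on the cone makes it
    independent of the way in which [x] is written as a difference. *)
Lemma cone_additive_extension (f : E -> E) :
  (forall x y, 0 <=v x -> 0 <=v y -> f (x + y) = f x + f y) ->
  (forall (a : R) x, 0 <= a -> 0 <=v x -> f (a *: x) = a *: f x) ->
  exists g : {linear E -> E}, forall x, 0 <=v x -> g x = f x.
Proof.
move=> fD fZ.
pose h x := f (vpos x) - f (vpos (- x)).
have hB x y : 0 <=v x -> 0 <=v y -> h (x - y) = f x - f y.
  move=> x0 y0; rewrite /h; apply/eqP; rewrite subr_eq_subr -!fD//;
    try exact: vpos_ge0.
  by apply/eqP; congr f; apply/eqP; rewrite -subr_eq_subr vposBneg.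
have hD x y : h (x + y) = h x + h y.
  rewrite -[in LHS](vposBneg x) -[in LHS](vposBneg y) addrACA -opprD.
  by rewrite hB ?fD ?opprD 1?addrACA//; try (by apply: vaddr_ge0; exact: vpos_ge0);
    exact: vpos_ge0.
have hN x : h (- x) = - h x by rewrite /h opprK opprB.
have hZ (a : R) x : 0 <= a -> h (a *: x) = a *: h x.
  move=> a0; rewrite /h -scalerN !vposZ// !fZ//; try exact: vpos_ge0.
  by rewrite scalerBr.
have h_lin : linear h.
  move=> a x y; rewrite hD; congr (_ + _); have [a0|a0] := leP 0 a.
    exact: hZ.
  rewrite -[a]opprK scaleNr hN hZ ?oppr_ge0 ?ltW//.
  by rewrite [RHS]scaleNr.
pose g : {linear E -> E} := HB.pack h (GRing.isLinear.Build R E E *:%R h h_lin).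
have v00 : 0 <=v (0 : E) by exact: vle_refl.
have f0 : f 0 = 0 by have := fZ 0 0 (lexx _) v00; rewrite !scale0r.
by exists g => x x0; rewrite -[LHS]/(h x) -{1}[x]subr0 hB// f0 subr0.
Qed.

End additive_on_cone.

(** * Order continuity of the norm and the modulus of an operator *)

Section order_continuity.
Context {R : realType} {E : banachLatticeType R}.
Hypothesis ocn : order_continuous_norm E.
Implicit Types (x y z u v w : E) (A : set E).

(** The differences between upper bounds and elements of [A] form a downward
    directed set.  Its infimum is 0: if [w] is a lower bound then subtracting
    [w] from an upper bound gives another one, so [b - n w] is an upper bound
    for all [n] and the Archimedean property applies. *)
Lemma oc_gap A b : A !=set0 ->
  (forall x y, A x -> A y -> exists z, [/\ A z, x <=v z & y <=v z]) ->
  (forall x, A x -> x <=v b) ->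
  forall e : R, 0 < e -> exists x y,
    [/\ A x, forall z, A z -> z <=v y & `|y - x| < e].
Proof.
move=> [x0 Ax0] dirA Ab e e0.
pose D := [set d | exists x y, [/\ A x, forall z, A z -> z <=v y & d = y - x]].
have [| | |d [x [y [Ax yub ->]]]] := ocn (D := D) _ _ _ e0.
- by exists (b - x0), x0, b.
- move=> _ _ [x [y [Ax yub ->]]] [x' [y' [Ax' y'ub ->]]].
  have [x'' [Ax'' xx'' x'x'']] := dirA _ _ Ax Ax'.
  exists (vmeet y y' - x''); split.
  + exists x'', (vmeet y y'); split=> // z Az.
    by apply: vmeet_ge; [exact: yub|exact: y'ub].
  + by apply: vleD; [exact: vmeet_lel|exact: vleN2].
  + by apply: vleD; [exact: vmeet_ler|exact: vleN2].
- split=> //.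
    by move=> _ [x [y [Ax yub ->]]]; apply/vsub_ge0; exact: yub.
  move=> w _ wD.
  have wub (n : nat) : forall x, A x -> x <=v b - n%:R *: w.
    elim: n => [|n IH] x Ax; first by rewrite scale0r subr0; exact: Ab.
    have : w <=v (b - n%:R *: w) - x by apply: wD; exists x, (b - n%:R *: w).
    move=> /vleBrD wx; rewrite -natr1 scalerDl scale1r opprD addrA.
    by apply/vleBrD; rewrite [x + w]addrC.
  apply: (@vle_archi _ _ _ (b - x0)) => n.
  have /vleBrD := wub n _ Ax0; rewrite addrC => h; exact/vleBrD.
by move=> ye; exists x, y; split=> //; apply: ye;
  [exists x, y|exact: vle_refl].
Qed.

(** Order continuity makes every bounded upward directed set a Cauchy net. *)
Lemma oc_directed_lub A b : A !=set0 ->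
  (forall x y, A x -> A y -> exists z, [/\ A z, x <=v z & y <=v z]) ->
  (forall x, A x -> x <=v b) ->
  exists2 m, is_lub vle setT A m &
    forall e : R, 0 < e -> exists2 x, A x & `|m - x| <= e.
Proof.
move=> A0 dirA Ab.
have h (n : nat) : exists xy : E * E,
    [/\ A xy.1, forall z, A z -> z <=v xy.2 & `|xy.2 - xy.1| < n.+1%:R^-1].
  have n0 : 0 < (n.+1%:R^-1 : R) by rewrite invr_gt0.
  by have [x [y ?]] := oc_gap A0 dirA Ab n0; exists (x, y).
have [xy hxy] := choice h.
pose x n := (xy n).1; pose y n := (xy n).2.
have Ax n : A (x n) by have [] := hxy n.
have yub n z : A z -> z <=v y n by have [_ + _] := hxy n; apply.
have dn n : `|y n - x n| < n.+1%:R^-1 by have [] := hxy n.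
have xx n m : `|x n - x m| <= n.+1%:R^-1 + m.+1%:R^-1.
  apply: (@le_trans _ _ `|(y n - x n) + (y m - x m)|); last first.
    by apply: le_trans (ler_normD _ _) _; apply: lerD; exact: ltW.
  have dge0 k : 0 <=v y k - x k by apply/vsub_ge0; exact: yub.
  apply: vnorm_le_abs; apply: vabs_le.
    apply: (vle_trans _ (vle_addl _ (dge0 n))).
    by apply: vle_add2r; exact: yub.
  rewrite opprB; apply: (vle_trans _ (vle_addr _ (dge0 m))).
  by apply: vle_add2r; exact: yub.
have /cvg_ex[m xm] : cvg (x n @[n --> \oo]).
  apply: cauchy_cvg; apply: cauchy_exP => e e0.
  have e20 : 0 < e / 2 by rewrite divr_gt0.
  have [N _ hN] := near_infty_natSinv_lt (PosNum e20).
  exists (x N); exists N => // m /= Nm.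
  rewrite -ball_normE /=; apply: le_lt_trans (xx _ _) _.
  by rewrite [e]splitr; apply: ltrD; apply: hN => /=.
have xmn e : 0 < e -> exists n, `|m - x n| <= e /\ n.+1%:R^-1 <= e.
  move=> e0; have [N1 _ hN1] := near_infty_natSinv_lt (PosNum e0).
  have /cvgrPdist_le /(_ _ e0) [N2 _ hN2] := xm.
  exists (N1 + N2)%N; split; first by apply: hN2 => /=; exact: leq_addl.
  by apply/ltW/hN1 => /=; exact: leq_addr.
exists m; last by move=> e e0; have [n [? _]] := xmn _ e0; exists (x n).
split=> //.
  move=> z Az; apply: vle_eps => e e0.
  have e20 : 0 < e / 2 by rewrite divr_gt0.
  have [n [mn ne]] := xmn _ e20.
  exists (y n - m); first by rewrite addrC subrK; exact: yub.
  rewrite -(subrK (x n) (y n)) -addrA [e]splitr.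
  apply: le_trans (ler_normD _ _) _; apply: lerD; last by rewrite distrC.
  by apply: le_trans ne; exact: ltW.
move=> u _ uub; apply: vle_eps => e e0.
have [n [mn _]] := xmn _ e0; exists (m - x n) => //.
by rewrite addrC -addrA; apply: vle_addr; rewrite addrC; apply/vsub_ge0; exact: uub.
Qed.

Inductive join_closure A : E -> Prop :=
| join_closure_in x : A x -> join_closure A x
| join_closure_join x y :
    join_closure A x -> join_closure A y -> join_closure A (vjoin x y).

Lemma join_closure_ub A b : (forall x, A x -> x <=v b) ->
  forall x, join_closure A x -> x <=v b.
Proof. by move=> Ab x; elim=> [y /Ab//|y z _ yb _ zb]; exact: vjoin_le. Qed.

(** Finite joins turn an arbitrary bounded set into a directed one with the
    same upper bounds. *)
Lemma oc_lub A b : A !=set0 -> (forall x, A x -> x <=v b) ->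
  exists m, is_lub vle setT A m.
Proof.
move=> [x0 Ax0] Ab.
have [| | |m [_ mub mleast] _] := @oc_directed_lub (join_closure A) b.
- by exists x0; exact: join_closure_in.
- move=> x y jx jy; exists (vjoin x y); split.
  + exact: join_closure_join.
  + exact: vle_joinl.
  + exact: vle_joinr.
- exact: join_closure_ub.
exists m; split=> // [x Ax|u _ uub].
  by apply: mub; exact: join_closure_in.
by apply: mleast => //; exact: join_closure_ub.
Qed.

End order_continuity.

Section order_norm.
Context {R : realType} {E : banachLatticeType R}.
Hypothesis ocn : order_continuous_norm E.
Implicit Types (x y z u v w : E).

Lemma is_lubD (A B C : set E) m n : is_lub vle setT A m -> is_lub vle setT B n ->
  (forall c, C c -> exists a b, [/\ A a, B b & c = a + b]) ->
  (forall a b, A a -> B b -> C (a + b)) ->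
  is_lub vle setT C (m + n).
Proof.
move=> [_ mub ml] [_ nub nl] CAB ABC; split=> // [c /CAB [a [b [Aa Bb ->]]]|u _ uub].
  by apply: vleD; [exact: mub|exact: nub].
rewrite addrC; apply/vleBrD; apply: nl => // b Bb; apply/vleBrD.
rewrite addrC; apply/vleBrD; apply: ml => // a Aa; apply/vleBrD.
exact/uub/ABC.
Qed.

Lemma is_lub_uniq (A : set E) m n :
  is_lub vle setT A m -> is_lub vle setT A n -> m = n.
Proof.
by move=> [_ mub ml] [_ nub nl]; apply: vle_anti; [exact: ml|exact: nl].
Qed.

Lemma regular_opD (L : E -> E) x y : regular_op L -> L (x + y) = L x + L y.
Proof.
by move=> [P [Q [_ _ LE]]]; rewrite !LE (linearD P) (linearD Q) opprD addrACA.
Qed.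

(** Riesz-Kantorovich: the modulus of [K] at [x >= 0] is the supremum of
    [K] over the order interval [-x, x]; additivity in [x] comes from the
    Riesz decomposition of the interval. *)
Lemma riesz_kantorovich (K : {linear E -> E}) :
  (forall x, 0 <=v x -> exists b, forall y, vabs y <=v x -> K y <=v b) ->
  exists2 N : {linear E -> E}, op_modulus K N &
    forall x b, 0 <=v x -> (forall y, vabs y <=v x -> K y <=v b) -> N x <=v b.
Proof.
move=> Kbd; pose I x := [set K y | y in [set y | vabs y <=v x]].
have exlub x : exists m, 0 <=v x -> is_lub vle setT (I x) m.
  have [x0|nx0] := pselect (0 <=v x); last by exists 0.
  have [b hb] := Kbd x x0.
  have [| |m hm] := @oc_lub _ _ ocn (I x) b.
  - exists (K 0), 0 => //=; rewrite vabs_id//; exact: vle_refl.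
  - by move=> _ [y /= yx <-]; exact: hb.
  by exists m.
have [f hf] := choice exlub.
have fD x y : 0 <=v x -> 0 <=v y -> f (x + y) = f x + f y.
  move=> x0 y0; apply: (is_lub_uniq (hf _ (vaddr_ge0 x0 y0))).
  apply: (is_lubD (hf _ x0) (hf _ y0)).
    move=> _ [w /= /vabs_leP[wl wr] <-].
    have two v : 0 <=v v -> 0 <=v v + v by move=> v0; exact: vaddr_ge0.
    (* Shifting by x + y moves the interval [-(x + y), x + y] into the cone. *)
    have [||||w1 [w2 [wE [w10 w1x] [w20 w2y]]]] :=
      @riesz_decomposition _ _ (w + (x + y)) (x + x) (y + y).
    - by have := vle_add2r (x + y) wl; rewrite addNr.
    - exact: two.
    - exact: two.
    - by rewrite addrACA; apply: vle_add2r.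
    exists (K (w1 - x)), (K (w2 - y)); split.
    + exists (w1 - x) => //=; apply: vabs_le; first exact/vleBlD.
      by rewrite opprB; exact: vle_subl.
    + exists (w2 - y) => //=; apply: vabs_le; first exact/vleBlD.
      by rewrite opprB; exact: vle_subl.
    + by rewrite -linearD addrACA -opprD -wE addrK.
  move=> _ _ [v /= vx <-] [w /= wy <-]; exists (v + w); last by rewrite linearD.
  by apply: (vle_trans (vabsD v w)); exact: vleD.
have fZ (a : R) x : 0 <= a -> 0 <=v x -> f (a *: x) = a *: f x.
  have le_scale b z : 0 < b -> 0 <=v z -> b *: f z <=v f (b *: z).
    move=> b0 z0; have bz0 := vle_scale (ltW b0) z0.
    have [_ _ fl] := hf _ z0; have [_ fub _] := hf _ bz0.
    have b1 : 0 < b^-1 by rewrite invr_gt0.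
    apply: (vleZK b1); rewrite scalerA mulVf ?gt_eqF// scale1r.
    apply: fl => // _ [y /= yz <-]; apply: (vleZK b0).
    rewrite scalerA mulfV ?gt_eqF// scale1r -linearZ; apply: fub.
    exists (b *: y) => //=; apply: (vle_trans (vabsZ_le _ _)).
    by rewrite ger0_norm ?ltW//; apply: vleZ => //; exact: ltW.
  rewrite le_eqVlt => /predU1P[<-|a0] x0.
    rewrite !scale0r; have := fD 0 0 (vle_refl _) (vle_refl _).
    by rewrite addr0 => /eqP; rewrite -subr_eq subrr eq_sym => /eqP.
  apply: vle_anti; last exact: le_scale.
  have a1 : 0 < a^-1 by rewrite invr_gt0.
  apply: (vleZK a1); rewrite [X in _ <=v X]scalerA mulVf ?gt_eqF// scale1r.
  have := le_scale _ _ a1 (vle_scale (ltW a0) x0).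
  by rewrite (scalerA a^-1 a x) mulVf ?gt_eqF// scale1r.
have [N NE] := cone_additive_extension fD fZ.
exists N; last first.
  move=> x b x0 hb; rewrite NE//; have [_ _ fl] := hf _ x0; apply: fl => //.
  by move=> _ [y /= yx <-]; exact: hb.
have Kle x y : 0 <=v x -> vabs y <=v x -> K y <=v N x.
  by move=> x0 yx; rewrite NE//; have [_ fub _] := hf _ x0; apply: fub; exists y.
have Npos : positive_op N.
  move=> x x0; rewrite -(linear0 K); apply: Kle => //.
  by rewrite vabs_id//; exact: vle_refl.
split.
- exists N, \0; split=> //; first by move=> x x0; exact: vle_refl.
  by move=> x; rewrite subr0.
- move=> _ [->|->] x x0; first by apply: Kle => //; rewrite vabs_id//; exact: vle_refl.
  by rewrite -linearN; apply: Kle => //; rewrite vabsN vabs_id//; exact: vle_refl.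
move=> U Ureg Uub x x0; rewrite NE//; have [_ _ fl] := hf _ x0.
have U1 : op_le K U by apply: Uub; left.
have U2 : op_le (fun x => - K x) U by apply: Uub; right.
have Upos y : 0 <=v y -> 0 <=v U y.
  move=> y0; apply: (vle_trans (vabs_ge0 (K y))).
  by apply: vabs_le; [exact: U1|exact: U2].
apply: fl => // _ [y /= yx <-].
rewrite -(vposBneg y) linearB /=.
apply: (@vle_trans _ _ (U (vpos y + vpos (- y)))).
  by rewrite regular_opD//; apply: vleD; [apply: U1|apply: U2]; exact: vpos_ge0.
rewrite vpos_split; apply/vsub_ge0; have -> : U x - U (vabs y) = U (x - vabs y).
  by apply/eqP; rewrite subr_eq -regular_opD// subrK.
by apply: Upos; apply/vsub_ge0.
Qed.

End order_norm.

(** * The Hahn-Banach theorem for sublinear functionals *)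

Section hahn_banach.
Context {R : realType} {V : lmodType R}.
Implicit Types (p q : V -> R) (x y z : V).

Definition sublinear p := (forall x y, p (x + y) <= p x + p y) /\
  (forall (a : R) x, 0 <= a -> p (a *: x) = a * p x).

Lemma sublinear0 p : sublinear p -> p 0 = 0.
Proof. by case=> _ pZ; have := pZ 0 0 (lexx _); rewrite scale0r mul0r. Qed.

Lemma sublinear_geN p x : sublinear p -> - p (- x) <= p x.
Proof.
move=> hp; have [pD _] := hp; rewrite -subr_ge0 opprK.
by rewrite -(sublinear0 hp) -(subrr x); exact: pD.
Qed.

(** The infimum of a family of functions is sublinear as soon as the axioms of
    sublinearity hold across the family; this serves both for infima of chains
    and for limits superior. *)
Lemma sublinear_inf (I : Type) (D : set I) (g : I -> V -> R) p :
  D !=set0 ->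
  (forall i x, D i -> - p (- x) <= g i x) ->
  (forall i j x y, D i -> D j -> exists2 k, D k & g k (x + y) <= g i x + g j y) ->
  (forall i (a : R) x, D i -> 0 < a -> exists2 k, D k & g k (a *: x) <= a * g i x) ->
  (forall i, D i -> g i 0 <= 0) -> p 0 = 0 ->
  sublinear (fun x => inf [set g i x | i in D]).
Proof.
move=> [i0 Di0] gp gD gZ g0 p0; pose S x := [set g i x | i in D].
have S0 x : S x !=set0 by exists (g i0 x), i0.
have Slb x : has_lbound (S x) by exists (- p (- x)) => _ [i Di <-]; exact: gp.
have Sle x i : D i -> inf (S x) <= g i x by move=> Di; apply: ge_inf => //; exists i.
have Sge x r : (forall i, D i -> r <= g i x) -> r <= inf (S x).
  by move=> h; apply: lb_le_inf => // _ [i Di <-]; exact: h.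
split=> [x y|a x].
  rewrite -lerBlDr; apply: (Sge) => i Di; rewrite lerBlDr -lerBlDl.
  apply: Sge => j Dj; rewrite lerBlDl.
  by have [k Dk] := gD i j x y Di Dj; apply: le_trans; exact: Sle.
have leZ b z : 0 < b -> inf (S (b *: z)) <= b * inf (S z).
  move=> b0; rewrite mulrC -ler_pdivrMr//; apply: Sge => i Di.
  rewrite ler_pdivrMr// mulrC.
  by have [k Dk] := gZ i b z Di b0; apply: le_trans; exact: Sle.
rewrite le_eqVlt => /predU1P[<-|a0].
  rewrite scale0r mul0r; apply/eqP; rewrite eq_le; apply/andP; split.
    by apply: le_trans (g0 _ Di0); exact: Sle.
  by apply: Sge => i Di; have := gp i 0 Di; rewrite oppr0 p0 oppr0.
apply/eqP; rewrite eq_le; apply/andP; split; first exact: leZ.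
have a1 : 0 < a^-1 by rewrite invr_gt0.
have := leZ _ (a *: x) a1; rewrite scalerA mulVf ?gt_eqF// scale1r.
by rewrite mulrC ler_pdivlMr// mulrC.
Qed.

(** [q y] is the infimum of [p (y + t x) - t p x] over [t >= 0]. *)
Lemma sublinear_steeper p x : sublinear p -> exists2 q, sublinear q &
  (forall y, q y <= p y) /\ q (- x) <= - p x.
Proof.
move=> hp; have [pD pZ] := hp.
pose g (t : R) y := p (y + t *: x) - t * p x.
pose D := [set t : R | 0 <= t].
have gp t y : D t -> - p (- y) <= g t y.
  move=> t0; rewrite /g lerBrDl -(pZ _ _ t0) lerBlDr.
  by apply: le_trans (pD _ _); rewrite addrAC subrr add0r.
have Slb y : has_lbound [set g t y | t in D].
  by exists (- p (- y)) => _ [t /(gp t y) ? <-].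
exists (fun y => inf [set g t y | t in D]).
  apply: (@sublinear_inf _ _ _ p) => //.
  - by exists 0; rewrite /D /=.
  - move=> s t y z s0 t0; exists (s + t); first exact: addr_ge0.
    rewrite /g scalerDl addrACA mulrDl opprD [leRHS]addrACA.
    by rewrite lerD2r; exact: pD.
  - move=> t a y t0 a0; exists (a * t); first by apply: mulr_ge0 => //; exact: ltW.
    by rewrite /g -scalerA -scalerDr pZ ?(ltW a0)// mulrBr mulrA.
  - by move=> t t0; rewrite /g add0r pZ// subrr.
  - exact: sublinear0.
split=> [y|].
  apply: ge_inf => //; exists 0; first by rewrite /D /=.
  by rewrite /g scale0r addr0 mul0r subr0.
apply: ge_inf => //; exists 1; first by rewrite /D /=.
by rewrite /g scale1r addNr sublinear0// mul1r sub0r.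
Qed.

(** A minimal sublinear functional is odd, since otherwise it could be made
    steeper in some direction; and an odd sublinear functional is linear. *)
Lemma sublinear_minorant p : sublinear p ->
  exists f : {scalar V}, forall x, f x <= p x.
Proof.
move=> hp; pose X := {q : V -> R | sublinear q /\ forall x, q x <= p x}.
pose le (q r : X) := `[< forall x, sval r x <= sval q x >].
have [| | | |[q [hq qp]] qmin] := @Zorn X le.
- by move=> q; apply/asboolP => x.
- move=> q r s /asboolP qr /asboolP rs; apply/asboolP => x.
  exact: le_trans (rs x) (qr x).
- move=> [q hq] [r hr] /asboolP /= qr /asboolP /= rq.
  apply: eq_exist; apply/funext => x.
  by apply/eqP; rewrite eq_le qr rq.
- move=> A Atot; have [A0|A0] := pselect (A !=set0); last first.
    have pX : sublinear p /\ forall x, p x <= p x by [].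
    by exists (exist _ p pX) => r Ar; exfalso; apply: A0; exists r.
  have gp (i : X) x : A i -> - p (- x) <= sval i x.
    case: i => q [hq qp] /= _; apply: le_trans (sublinear_geN x hq).
    by rewrite lerN2.
  pose q x := inf [set sval i x | i in A].
  have Slb x : has_lbound [set sval i x | i in A].
    by exists (- p (- x)) => _ [i /(gp i x) ? <-].
  have qA i x : A i -> q x <= sval i x.
    by move=> Ai; apply: ge_inf => //; exists i.
  have hq : sublinear q.
    apply: (@sublinear_inf _ _ _ p) => //.
    + move=> i j x y Ai Aj.
      have [/asboolP h|/asboolP h] := Atot _ _ Ai Aj.
        exists j => //; apply: (le_trans ((svalP j).1.1 x y)).
        by rewrite lerD2r.
      exists i => //; apply: (le_trans ((svalP i).1.1 x y)).
      by rewrite lerD2l.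
    + by move=> i a x Ai a0; exists i => //; rewrite (svalP i).1.2// (ltW a0).
    + by move=> i _; rewrite (sublinear0 (svalP i).1).
    + exact: sublinear0.
  have qp x : q x <= p x.
    by have [i Ai] := A0; apply: le_trans (qA i x Ai) _; exact: (svalP i).2.
  by exists (exist _ q (conj hq qp)) => r Ar; apply/asboolP => x; exact: qA.
(* minimality against the steeper functional in the direction x *)
have qN x : q (- x) = - q x.
  apply/eqP; rewrite eq_le; apply/andP; split; last first.
    by rewrite lerNl; exact: sublinear_geN.
  have [r hr [rq rx]] := sublinear_steeper x hq.
  have rp y : r y <= p y by exact: le_trans (rq y) (qp y).
  have := qmin (exist _ r (conj hr rp)) (asboolT rq).
  by move=> /(congr1 sval) /= rE; rewrite -{1}rE; exact: rx.
have [qD qZ] := hq.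
have q_lin : scalar q.
  move=> a x y.
  have -> : q (a *: x + y) = q (a *: x) + q y.
    apply/eqP; rewrite eq_le qD /= -lerBrDr -qN.
    by apply: le_trans (qD _ _); rewrite addrK.
  congr (_ + _); have [a0|a0] := leP 0 a; first exact: qZ.
  by rewrite -[a]opprK scaleNr qN qZ ?oppr_ge0 ?(ltW a0)// [RHS]mulNr.
exists (HB.pack q (GRing.isLinear.Build R V R *%R q q_lin) : {scalar V}).
exact: qp.
Qed.

(** A functional below [q] with [q (- e) <= - p e] takes at [e] at least the
    value [p e]. *)
Lemma hahn_banach p e : sublinear p ->
  exists2 f : {scalar V}, forall x, f x <= p x & f e = p e.
Proof.
move=> hp; have [q hq [qp qe]] := sublinear_steeper e hp.
have [f fq] := sublinear_minorant hq.
have fp x : f x <= p x by exact: le_trans (fq x) (qp x).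
exists f => //; apply/eqP; rewrite eq_le fp /=.
by rewrite -lerN2 -linearN; exact: le_trans (fq _) qe.
Qed.

End hahn_banach.

(** * Monotonicity from one-sided derivatives *)

Section right_derivative.
Context {R : realType} {V : normedModType R}.
Implicit Types (F G : R -> V) (D : V) (u : R -> R).

(** The generator only provides right derivatives of orbits, at [t = 0]
    included. *)
Definition right_derivative F (t : R) D :=
  (fun h => h^-1 *: (F (t + h) - F t)) @ (0 : R)^'+ --> D.

Definition half_line_continuous F := forall t : R, 0 <= t ->
  F @ within [set s : R | 0 <= s] (nbhs t) --> F t.

Lemma right_derivativeD F G t D D' : right_derivative F t D ->
  right_derivative G t D' -> right_derivative (fun s => F s + G s) t (D + D').
Proof.
move=> hF hG; apply: cvg_trans (cvgD hF hG). apply: near_eq_cvg.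
by near=> h; rewrite /= opprD addrACA scalerDr.
Unshelve. all: by end_near. Qed.

Lemma right_derivativeZ u F (t du : R) D : is_derive t 1 u du ->
  right_derivative F t D ->
  right_derivative (fun s => u s *: F s) t (u t *: D + du *: F t).
Proof.
move=> hu hF.
have ucvg : (fun h => u (t + h)) @ (0 : R)^'+ --> u t.
  apply: cvg_at_right_filter.
  have uc : u x @[x --> t] --> u t.
    exact/differentiable_continuous/derivable1_diffP/(@ex_derive _ _ _ _ _ _ _ hu).
  have tcvg : (fun h => t + h) @ (0 : R) --> t.
    by rewrite -[X in _ --> X]addr0; apply: cvgD; [exact: cvg_cst|exact: cvg_id].
  exact: (@cvg_comp _ _ _ (fun h => t + h) u _ _ _ tcvg uc).
have ducvg : (fun h => h^-1 * (u (t + h) - u t)) @ (0 : R)^'+ --> du.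
  apply: cvg_dnbhs_at_right.
  rewrite -[X in _ --> X](@derive_val _ _ _ _ _ _ _ hu).
  apply: cvg_trans (@ex_derive _ _ _ _ _ _ _ hu); apply: near_eq_cvg.
  by near=> h; rewrite /= [h *: 1]mulr1 [h + t]addrC.
apply: cvg_trans (cvgD (cvgZ ucvg hF) (cvgZr_tmp (a := F t) ducvg)).
apply: near_eq_cvg.
near=> h; rewrite addrfctE scalerA mulrC -2!scalerA -scalerDr; congr (_ *: _).
by rewrite scalerBr scalerBl addrA subrK.
Unshelve. all: by end_near. Qed.

Lemma half_line_continuousD F G : half_line_continuous F ->
  half_line_continuous G -> half_line_continuous (fun s => F s + G s).
Proof. by move=> hF hG t t0; apply: cvgD; [exact: hF|exact: hG]. Qed.

Lemma half_line_continuousZ u F : continuous u -> half_line_continuous F ->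
  half_line_continuous (fun s => u s *: F s).
Proof.
move=> hu hF t t0; apply: cvgZ; last exact: hF.
by apply: cvg_within_filter; exact: hu.
Qed.

End right_derivative.

Lemma is_derive_comp_affine (R : realType) (f : R -> R) (a b t df : R) :
  is_derive (a + b * t) 1 f df ->
  is_derive t 1 (fun s => f (a + b * s)) (b * df).
Proof.
move=> fd; have h : is_derive t (1 : R) (fun s => a + b * s) b.
  have := is_deriveD (is_derive_cst a t 1) (is_deriveZ b (is_derive_id t 1)).
  by rewrite add0r [_ *: 1]mulr1.
by rewrite mulrC; exact: (is_derive1_comp (g := fun s => a + b * s)).
Qed.

Section dini.
Context {R : realType}.

(** For every slope [e > 0], the times up to which [k s <= e s] holds form a
    closed interval, and the derivative bound lets it be prolonged to the right. *)
Lemma dini_le0 (k : R -> R) : half_line_continuous k -> k 0 <= 0 ->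
  (forall t e : R, 0 <= t -> 0 < e ->
     \forall h \near (0 : R)^'+, k (t + h) <= k t + e * h) ->
  forall t : R, 0 <= t -> k t <= 0.
Proof.
move=> kc k0 kd b b0; apply/ler_addgt0Pl => e' e'0; rewrite addr0.
pose e := e' / (b + 1).
have e0 : 0 < e by rewrite divr_gt0// ltr_wpDl.
suff : k b <= e * b.
  move=> /le_trans; apply; rewrite /e mulrAC ler_pdivrMr ?ltr_wpDl//.
  by rewrite ler_pM2l// lerDl.
pose S := [set t : R | [/\ 0 <= t, t <= b & forall s : R, 0 <= s -> s <= t -> k s <= e * s]].
have S0 : S 0.
  split=> // s s0 s0'; have -> : s = 0 by apply/eqP; rewrite eq_le s0 s0'.
  by rewrite mulr0.
have Sub : has_ubound S by exists b => t [].
have Ssup : has_sup S by split=> //; exists 0.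
pose m := sup S.
have m0 : 0 <= m by exact: ub_le_sup.
have mb : m <= b by apply: ge_sup => [|t []//]; exists 0.
(* S is an initial segment with supremum m; m = b will be shown. *)
have ltm (s : R) : 0 <= s -> s < m -> k s <= e * s.
  move=> s0 sm; have ms0 : 0 < m - s by rewrite subr_gt0.
  have [t [t0 tb ht]] := sup_adherent ms0 Ssup.
  by rewrite subKr => st; apply: ht => //; exact: ltW.
have km : k m <= e * m.
  have [->|mneq0] := eqVneq m 0; first by rewrite mulr0.
  have {mneq0}m_gt0 : 0 < m by rewrite lt_neqAle eq_sym mneq0.
  rewrite leNgt; apply/negP => km.
  have d0 : 0 < k m - e * m by rewrite subr_gt0.
  have /cvgrPdist_lt/(_ _ d0) := kc m m0.
  rewrite near_withinE => -[d /= dgt0 hd].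
  pose s := Num.max 0 (m - d / 2).
  have s0 : 0 <= s by rewrite le_max lexx.
  have sm : s < m by rewrite gt_max m_gt0 ltrBlDr ltrDl divr_gt0.
  have := hd s _ s0; rewrite /= !/ball_ ger0_norm ?subr_ge0 ?ltW//.
  have : m - s < d.
    rewrite ltrBlDr -ltrBlDl lt_max; apply/orP; right.
    by rewrite ltrD2l ltrN2 ltr_pdivrMr// ltr_pMr// ltr1n.
  move=> msd /(_ msd).
  have := ltm s s0 sm => ks; rewrite ltNge => /negP; apply.
  apply: le_trans (ler_norm _); apply: lerB => //; apply: le_trans ks _.
  by rewrite ler_pM2l// ltW.
have [mb'|mltb] := leP b m.
  by have -> : b = m by apply/eqP; rewrite eq_le mb' mb.
exfalso.
have := kd m e m0 e0; rewrite /at_right near_withinE => -[d /= dgt0 hd].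
pose h := Num.min (d / 2) (b - m).
have h0 : 0 < h by rewrite lt_min divr_gt0//= subr_gt0.
suff : S (m + h) by move=> /(ub_le_sup Sub); rewrite leNgt ltrDl h0.
split; first by rewrite addr_ge0// ltW.
  by rewrite -lerBrDl ge_min lexx orbT.
move=> s s0 sh; have [sm|ms] := ltP s m; first exact: ltm.
move: ms; rewrite le_eqVlt => /predU1P[<-//|ms].
have := hd (s - m) _ _; rewrite subrKC => hs; apply: le_trans (hs _ _) _.
- rewrite /= sub0r normrN gtr0_norm ?subr_gt0// ltrBlDl.
  apply: le_lt_trans sh _; rewrite ltrD2l gt_min ltr_pdivrMr// ltr_pMr// ltr1n//.
- by rewrite subr_gt0.
by rewrite mulrBr addrCA -[leRHS]addr0 lerD2l subr_le0.
Qed.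

End dini.

Section vector_dini.
Context {R : realType} {E : banachLatticeType R}.

Lemma vpos_lipschitz (x y : E) : `| (`|vpos x| - `|vpos y|) | <= `|x - y|.
Proof.
have h (a b : E) : `|vpos a| <= `|vpos b| + `|a - b|.
  rewrite -{1}(subrK b a) addrC; apply: le_trans (lerD (lexx _) (vnorm_pos _)).
  apply: le_trans (ler_normD _ _); apply: vnorm_mono; first exact: vpos_ge0.
  exact: vposD.
by rewrite ler_norml lerNl opprB !lerBlDl h distrC h.
Qed.

(** Apply [dini_le0] to the norm of [(G t - G 0)^+]: a nonpositive derivative
    contributes nothing to the positive part. *)
Lemma right_derivative_le0 (G : R -> E) : half_line_continuous G ->
  (forall t, 0 <= t -> exists2 D, right_derivative G t D & D <=v 0) ->
  forall t, 0 <= t -> G t <=v G 0.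
Proof.
move=> Gc Gd; pose k t := `|vpos (G t - G 0)|.
have kle0 t : 0 <= t -> k t <= 0.
  apply: dini_le0.
  - move=> s s0; apply/cvgrPdist_le => e e0.
    have /cvgrPdist_le/(_ _ e0) := Gc s s0; apply: filterS => r.
    apply: le_trans; apply: le_trans (vpos_lipschitz _ _) _.
    by rewrite opprB addrA subrK.
  - by rewrite /k subrr vpos_id ?normr0//; exact: vle_refl.
  - move=> s e s0 e0; have [D hD D0] := Gd s s0.
    have /cvgrPdist_le/(_ _ e0) hD' := hD.
    near=> h; have h0 : 0 < h by near: h; exact: nbhs_right_gt.
    have hh : `|D - h^-1 *: (G (s + h) - G s)| <= e by near: h.
    set r := h^-1 *: _ in hh.
    have GE : G (s + h) - G s = h *: r.
      by rewrite /r scalerA mulfV ?gt_eqF// scale1r.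
    rewrite /k -(subrK (G s) (G (s + h))) GE -addrA addrC.
    apply: le_trans (_ : `|vpos (G s - G 0) + vpos (h *: (r - D))| <= _).
      apply: vnorm_mono; first exact: vpos_ge0.
      apply: (vle_trans (vposD _ _)); apply: vle_add2l; apply: vpos_mono.
      apply: vleZ; first exact: ltW.
      by apply: vle_addr; rewrite -oppr0; exact: vleN2.
    apply: le_trans (ler_normD _ _) _; rewrite lerD2l.
    apply: le_trans (vnorm_pos _) _.
    by rewrite normrZ gtr0_norm// mulrC ler_pM2r// distrC.
move=> t t0; apply/vsub_ge0; rewrite -opprB -oppr0; apply: vleN2.
have -> : 0 = vpos (G t - G 0); last exact: vle_pos.
by apply/esym/eqP; rewrite -normr_le0; exact: kle0.
Unshelve. all: by end_near. Qed.

End vector_dini.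

(** * Semigroups, generators and real resolvents *)

Lemma linear_continuous_bound (R : realType) (V W : normedModType R)
    (f : {linear V -> W}) : continuous f ->
  exists2 C : R, 0 < C & forall x, `|f x| <= C * `|x|.
Proof.
move=> /linear_bounded_continuous/linear_boundedP/pinfty_ex_gt0[C C0 hC].
by exists C.
Qed.

Section generator.
Context {R : realType} {E : banachLatticeType R}.
Variable T : R -> {linear E -> E}.
Hypothesis T_C0 : C0_semigroup T.
Implicit Types (x y z g : E) (t s l : R).
Let A := generator T.

Lemma semigroupD t s x : 0 <= t -> 0 <= s -> T (t + s) x = T t (T s x).
Proof. by case: T_C0 => _ _ + _ ? ?; apply. Qed.

Lemma semigroup_comm t s x : 0 <= t -> 0 <= s -> T t (T s x) = T s (T t x).
Proof. by move=> ? ?; rewrite -!semigroupD// addrC. Qed.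

Lemma orbit_continuous x : half_line_continuous (T^~ x).
Proof.
by move=> t t0; have [_ _ _ /(_ x)/subspace_continuousP/(_ _ t0)] := T_C0.
Qed.

Lemma generator_cvg x : dom A x ->
  (fun h => h^-1 *: (T h x - x)) @ (0 : R)^'+ --> A x.
Proof. by []. Qed.

Lemma generator_lim x y :
  (fun h => h^-1 *: (T h x - x)) @ (0 : R)^'+ --> y -> dom A x /\ A x = y.
Proof.
by move=> h; split; [exact: (cvgP _ h)|exact: (cvg_lim (@norm_hausdorff _ _) h)].
Qed.

Lemma generator_orbit_cvg t x : 0 <= t -> dom A x ->
  (fun h => T t (h^-1 *: (T h x - x))) @ (0 : R)^'+ --> T t (A x).
Proof.
move=> t0 /generator_cvg hx; have [/(_ t t0) Tc _ _ _] := T_C0.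
by apply: continuous_cvg hx; exact: Tc.
Qed.

Lemma orbit_right_derivative t x : 0 <= t -> dom A x ->
  right_derivative (T^~ x) t (T t (A x)).
Proof.
move=> t0 hx; apply: cvg_trans (generator_orbit_cvg t0 hx); apply: near_eq_cvg.
near=> h; have h0 : 0 < h by near: h; exact: nbhs_right_gt.
by rewrite semigroupD ?(ltW h0)// linearZ linearB.
Unshelve. all: by end_near. Qed.

Lemma generator_orbit t x : 0 <= t -> dom A x ->
  dom A (T t x) /\ A (T t x) = T t (A x).
Proof.
move=> t0 hx; apply: generator_lim.
apply: cvg_trans (generator_orbit_cvg t0 hx); apply: near_eq_cvg.
near=> h; have h0 : 0 < h by near: h; exact: nbhs_right_gt.
by rewrite semigroup_comm ?(ltW h0)// linearZ linearB.
Unshelve. all: by end_near. Qed.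

Lemma generator0 : dom A 0 /\ A 0 = 0.
Proof.
apply: generator_lim; under eq_fun do rewrite linear0 subr0 scaler0.
exact: cvg_cst.
Qed.

Definition real_resolvent (B : partial_op E) l (S : {linear E -> E}) :=
  (forall x, dom B (S x) /\ l *: S x - B (S x) = x) /\
  (forall x, dom B x -> S (l *: x - B x) = x).

(** The supremum of [cos t x] over [t] is attained at [t = 0] or [t = pi] and
    equals the modulus of [x]. *)
Lemma cnorm_real x : cnorm ((x, 0) : complexification E) = `|x|.
Proof.
rewrite /cnorm -(vnorm_abs x); congr (`|_|); rewrite /cmodulus /=.
set D := [set _ | t in _].
have h : is_lub vle setT D (vabs x).
  split=> // [_ [t _ <-]|u _ uub].
    rewrite scaler0 addr0; apply: (vle_trans (vabs_ge _)).
    apply: (vle_trans (vabsZ_le _ _)); rewrite -[X in _ <=v X]scale1r.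
    by apply: vleZr; [exact: cos_max|exact: vabs_ge0].
  apply: vabs_le; apply: uub.
    by exists 0 => //; rewrite cos0 scale1r scaler0 addr0.
  by exists pi => //; rewrite cospi scaleN1r scaler0 addr0.
by apply: (is_lub_uniq _ h); apply: xgetPex; exists (vabs x).
Qed.

(** A resolvent of the complexified generator at a real point maps real
    vectors to real vectors, because [l - A] is injective. *)
Lemma Abel_bounded_real : Abel_bounded (complexify A) ->
  exists2 M : R, 1 <= M & forall l, 0 < l -> exists2 S, real_resolvent A l S &
    forall x, `|l *: S x| <= M * `|x|.
Proof.
move=> [_ [M hM]]; exists (Num.max M 1); first by rewrite le_max lexx orbT.
move=> l l0; have [S [_ S1 S2] Sbd] := hM l l0.
pose EC := complexification E.
have scaleE (a : R) (z : EC) : a%:C%C *: z = (a *: z.1, a *: z.2).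
  rewrite -[LHS]/(a *: z.1 - 0 *: z.2, a *: z.2 + 0 *: z.1).
  by rewrite !scale0r subr0 addr0.
have Sreal x : (S ((x, 0) : EC)).2 = 0.
  have [[d1 d2] hS] := S1 ((x, 0) : EC).
  set q := (S _).2 in d2 hS *.
  have hq : l *: q - A q = 0 by have := congr1 snd hS; rewrite scaleE.
  have [d0 A0] := generator0.
  have l00 : l *: 0 - A 0 = 0 by rewrite A0 scaler0 subr0.
  have := S2 ((0, q) : EC) (conj d0 d2).
  rewrite scaleE.
  have -> : ((l *: 0, l *: q) : EC) - complexify A ((0, q) : EC) = 0.
    exact: (f_equal2 pair l00 hq).
  by rewrite linear0 => /(congr1 snd) /= <-.
pose f x := (S ((x, 0) : EC)).1.
have Sf x : S ((x, 0) : EC) = (f x, 0) :> EC.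
  by rewrite [LHS]surjective_pairing Sreal.
have f_lin : linear f.
  move=> a x y; rewrite /f.
  have -> : ((a *: x + y, 0) : EC) = a%:C%C *: ((x, 0) : EC) + ((y, 0) : EC).
    by rewrite scaleE /=; congr pair => /=; rewrite scaler0 addr0.
  by rewrite linearP scaleE.
pose F : {linear E -> E} := HB.pack f (GRing.isLinear.Build R E E *:%R f f_lin).
exists F; first split.
- move=> x; have [[d1 _] /(congr1 fst)] := S1 ((x, 0) : EC).
  by rewrite scaleE.
- move=> x dx; have [d0 A0] := generator0.
  have l00 : l *: 0 - A 0 = 0 by rewrite A0 scaler0 subr0.
  have := S2 ((x, 0) : EC) (conj dx d0); rewrite scaleE /=.
  have -> : ((l *: x, l *: 0) : EC) - (A x, A 0) = ((l *: x - A x, 0) : EC).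
    exact: (f_equal2 pair (erefl _) l00).
  by rewrite Sf => /(congr1 fst).
- move=> x; rewrite -(cnorm_real (l *: F x)) -(cnorm_real x).
  have -> : ((l *: F x, 0) : EC) = l%:C%C *: S ((x, 0) : EC).
    by rewrite Sf scaleE /= scaler0.
  apply: le_trans (Sbd _) _; rewrite ler_wpM2r ?le_max ?lexx//.
  by rewrite normr_ge0.
Qed.

End generator.

(** * Positivity of the resolvent *)

Section positive_resolvent.
Context {R : realType} {E : banachLatticeType R}.
Variable T : R -> {linear E -> E}.
Hypothesis T_C0 : C0_semigroup T.
Hypothesis T_pos : positive_semigroup T.
Implicit Types (x y z g : E) (t s l : R) (S : {linear E -> E}).
Let A := generator T.

Lemma positive_op_mono (f : {linear E -> E}) x y :
  positive_op f -> x <=v y -> f x <=v f y.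
Proof.
by move=> f0 /vsub_ge0/f0; rewrite linearB => /vsub_ge0.
Qed.

Lemma is_derive_expN l t :
  is_derive t 1 (fun s => expR (- l * s)) (- l * expR (- l * t)).
Proof.
have := @is_derive_comp_affine R expR 0 (- l) t _ (is_derive_expR _).
by rewrite add0r; under eq_fun do rewrite add0r.
Qed.

(** The derivative of [exp (- l t) (T t y - g / l)] is
    [exp (- l t) (g - T t (l y - A y)) <= 0]. *)
Lemma generator_orbit_bound l y g : 0 < l -> dom A y ->
  (forall t, 0 <= t -> g <=v T t (l *: y - A y)) ->
  forall t, 0 <= t -> expR (- l * t) *: (T t y - l^-1 *: g) <=v y - l^-1 *: g.
Proof.
move=> l0 dy hg t t0.
pose G s := expR (- l * s) *: (T s y + - (l^-1 *: g)).
have G0 : G 0 = y - l^-1 *: g.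
  by rewrite /G mulr0 expR0 scale1r; case: T_C0 => _ -> _ _.
rewrite -G0 -/(G t); apply: right_derivative_le0 => //.
  apply: half_line_continuousZ.
    move=> s; apply: continuous_comp; last exact: continuous_expR.
    by apply: cvgM; [exact: cvg_cst|exact: cvg_id].
  apply: half_line_continuousD; first exact: orbit_continuous.
  by move=> s s0; exact: cvg_cst.
move=> s s0.
have rd := orbit_right_derivative T_C0 s0 dy.
have rc : right_derivative (fun=> - (l^-1 *: g)) s 0.
  rewrite /right_derivative; under eq_fun do rewrite subrr scaler0.
  exact: cvg_cst.
have := right_derivativeZ (is_derive_expN l s) (right_derivativeD rd rc).
rewrite addr0 => rG; eexists; first exact: rG.
rewrite [- l * expR _]mulrC -scalerA -scalerDr -[X in _ <=v X](scaler0 _ (expR (- l * s))).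
apply: vleZ; first exact: expR_ge0.
rewrite scalerDr scaleNr scalerN scaleNr opprK scalerA mulfV ?gt_eqF// scale1r.
rewrite addrA; have := hg s s0; rewrite linearB linearZ /= => /vleN2.
by rewrite opprB => /(vle_add2r g); rewrite addNr.
Qed.

Lemma semigroup_bound : exists2 C : R, 0 < C &
  forall (n : nat) x, `|T n%:R x| <= C ^+ n * `|x|.
Proof.
have [/(_ 1 ler01) Tc T0 _ _] := T_C0.
have [C C0 hC] := linear_continuous_bound Tc; exists C => //.
elim=> [|n IH] x; first by rewrite T0 expr0 mul1r.
rewrite -natr1 addrC (semigroupD T_C0)//; apply: le_trans (hC _) _.
by rewrite exprS -mulrA ler_pM2l.
Qed.

(** For [x >= 0] and [y = S x] the vector [exp (- l n) T n y] lies below [y]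
    and tends to 0 when [exp l] exceeds the norm of [T 1]. *)
Lemma resolvent_positive_large : exists2 l0 : R, 0 < l0 &
  forall l S, l0 <= l -> real_resolvent A l S -> positive_op S.
Proof.
have [C C0 hC] := semigroup_bound; exists C => // l S Cl [hS _] x x0.
have l0 : 0 < l := lt_le_trans C0 Cl.
have [dy hy] := hS x; set y := S x in dy hy *.
have hg t : 0 <= t -> 0 <=v T t (l *: y - A y) by move=> t0; rewrite hy; exact: T_pos.
have bd := generator_orbit_bound l0 dy hg.
pose q := expR (- l) * C.
have q0 : 0 < q by rewrite mulr_gt0// expR_gt0.
have q1 : q < 1.
  rewrite /q expRN mulrC ltr_pdivrMr ?expR_gt0// mul1r.
  apply: lt_le_trans (expR_ge1Dx l); rewrite addrC.
  by apply: le_lt_trans Cl _; rewrite ltrDl.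
apply: vle_eps => e e0.
have : (fun n => q ^+ n * `|y|) @ \oo --> (0 : R).
  rewrite -(mul0r `|y|); apply: cvgM; last exact: cvg_cst.
  by apply: cvg_expr; rewrite gtr0_norm.
move=> /cvgrPdist_le/(_ _ e0)[N _ /(_ N (leqnn N))].
rewrite sub0r normrN ger0_norm; last by rewrite mulr_ge0// exprn_ge0// ltW.
move=> qN; exists (- (expR (- l * N%:R) *: T N%:R y)).
  have := bd N%:R (ler0n _ _); rewrite scaler0 !subr0.
  by move=> /(vle_add2r (- (expR (- l * N%:R) *: T N%:R y))); rewrite subrr.
rewrite normrN normrZ gtr0_norm ?expR_gt0//; apply: le_trans qN.
rewrite exprMn -mulrA -expRM_natr; apply: ler_pM => //; exact: expR_ge0.
Qed.

(** By the resolvent equation, [y = S' x] satisfies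
    [y = S x + (l - mu) S y], hence [y^- <= (l - mu) S y^-].  The operator
    on the right is a strict contraction, so [y^- = 0]. *)
Lemma resolvent_positive_step M l mu S S' : 0 < mu -> mu <= l ->
  real_resolvent A l S -> positive_op S ->
  (forall x, `|l *: S x| <= M * `|x|) -> (l - mu) * M < l ->
  real_resolvent A mu S' -> positive_op S'.
Proof.
move=> mu0 mul hS S0 SM lM hS' x x0.
have l0 : 0 < l := lt_le_trans mu0 mul.
have [dy hy] := hS'.1 x; set y := S' x in dy hy *.
have k0 : 0 <= l - mu by rewrite subr_ge0.
have yE : y = S (x + (l - mu) *: y).
  rewrite -{1}(hS.2 _ dy); congr (S _).
  by rewrite -hy scalerBl [RHS]addrC -addrA; congr (_ + _); rewrite addrA addNr sub0r.
have p_le : vpos (- y) <=v (l - mu) *: S (vpos (- y)).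
  apply: vpos_le; last by apply: vle_scale => //; apply: S0; exact: vpos_ge0.
  rewrite {1}yE linearD linearZ opprD /=.
  apply: (@vle_trans _ _ (- ((l - mu) *: S y))).
    rewrite -[X in _ <=v X]add0r; apply: vle_add2r; apply: voppr_le0; exact: S0.
  rewrite -scalerN -linearN; apply: vleZ => //.
  by apply: positive_op_mono => //; exact: vle_pos.
have p0 : vpos (- y) = 0.
  apply/eqP; rewrite -normr_eq0; apply/negP => /negP pn0.
  have {}pn0 : 0 < `|vpos (- y)| by rewrite lt_neqAle eq_sym pn0 normr_ge0.
  have := vnorm_mono (vpos_ge0 _) p_le; rewrite leNgt => /negP; apply.
  rewrite normrZ ger0_norm//.
  have := SM (vpos (- y)); rewrite normrZ gtr0_norm// => SMp.
  rewrite -(ltr_pM2l l0) mulrCA.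
  apply: le_lt_trans (ler_wpM2l k0 SMp) _.
  by rewrite mulrA ltr_pM2r.
by have := vposBneg (- y); rewrite p0 sub0r opprK => /oppr_inj <-; exact: vpos_ge0.
Qed.

(** The bound on [l S] allows to go from [l] down to [l q] with
    [q = 1 - 1 / (2 M)] independent of [l], and [l0 q^n] tends to 0. *)
Lemma resolvent_positive M : 1 <= M ->
  (forall l, 0 < l -> exists2 S, real_resolvent A l S &
    forall x, `|l *: S x| <= M * `|x|) ->
  forall l S, 0 < l -> real_resolvent A l S -> positive_op S.
Proof.
move=> M1 hM; have [l0 l00 hl0] := resolvent_positive_large.
have M0 : 0 < M := lt_le_trans ltr01 M1.
pose q : R := 1 - (2 * M)^-1.
have M2 : 1 < 2 * M by rewrite (lt_le_trans (ltr1n _ 2))// ler_pMr.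
have q0 : 0 < q by rewrite subr_gt0 invf_lt1// (lt_trans ltr01).
have q1 : q < 1 by rewrite ltrBlDr ltrDl invr_gt0 mulr_gt0.
have step (n : nat) l S : l0 * q ^+ n <= l -> real_resolvent A l S -> positive_op S.
  elim: n l S => [|n IH] l S; first by rewrite expr0 mulr1; exact: hl0.
  move=> ll; have lpos : 0 < l.
    by apply: lt_le_trans ll; rewrite mulr_gt0// exprn_gt0.
  have lq0 : 0 < l / q by rewrite divr_gt0.
  have [S1 hS1 S1M] := hM _ lq0.
  apply: (@resolvent_positive_step M (l / q) l S1) => //.
  - by rewrite ler_pdivlMr// ler_piMr// ltW.
  - by apply: IH hS1; rewrite ler_pdivlMr// -mulrA -exprSr.
  have -> : l / q - l = l / q * (2 * M)^-1.
    by rewrite -{2}(divfK (negbT (gt_eqF q0)) l) -{1}[l / q]mulr1 -mulrBr /q subKr.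
  rewrite -mulrA gtr_pMr// invfM -mulrA mulVf ?gt_eqF// mulr1.
  by rewrite invf_lt1// ltr1n.
move=> l S lpos; have : (fun n => l0 * q ^+ n) @ \oo --> (0 : R).
  rewrite -(mulr0 l0); apply: cvgM; first exact: cvg_cst.
  by apply: cvg_expr; rewrite gtr0_norm.
move=> /cvgrPdist_le/(_ _ lpos)[N _ /(_ N (leqnn N))].
rewrite sub0r normrN ger0_norm; last by rewrite mulr_ge0 ?exprn_ge0// ltW.
exact: step.
Qed.

Lemma resolvent_orbit l S t x : 0 <= t -> real_resolvent A l S ->
  S (T t x) = T t (S x).
Proof.
move=> t0 [S1 S2]; have [dx hx] := S1 x.
have [dT AT] := generator_orbit T_C0 t0 dx.
by rewrite -(S2 _ dT) AT -linearZ -linearB hx.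
Qed.

Lemma resolvent_orbit_le l S t x : 0 < l -> real_resolvent A l S ->
  0 <= t -> 0 <=v x -> expR (- l * t) *: T t (S x) <=v S x.
Proof.
move=> l0 [S1 _] t0 x0; have [dx hx] := S1 x.
have := generator_orbit_bound (g := 0) l0 dx _ t0.
rewrite scaler0 !subr0; apply => s s0; rewrite hx; exact: T_pos.
Qed.

(** Formally [l S g] is the average of [T t g] against the probability density
    [l exp (- l t)]. *)
Lemma resolvent_superharmonic l S g : 0 < l -> real_resolvent A l S ->
  positive_op S -> 0 <=v g -> (forall t, 0 <= t -> g <=v T t g) ->
  g <=v l *: S g.
Proof.
move=> l0 [S1 _] Spos g0 hg; have [dx hx] := S1 g.
have bd := generator_orbit_bound l0 dx (g := g).
rewrite hx in bd; have {}bd := bd hg.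
have l1 : 0 < l^-1 by rewrite invr_gt0.
apply: (vleZK l1); rewrite scalerA mulVf ?gt_eqF// scale1r.
apply: vle_eps => e e0.
have : (fun n : nat => expR (- l) ^+ n * `|l^-1 *: g|) @ \oo --> (0 : R).
  rewrite -(mul0r `|l^-1 *: g|); apply: cvgM; last exact: cvg_cst.
  by apply: cvg_expr; rewrite gtr0_norm ?expR_gt0// expR_lt1 oppr_lt0.
move=> /cvgrPdist_le/(_ _ e0)[N _ /(_ N (leqnn N))].
rewrite sub0r normrN ger0_norm; last by rewrite mulr_ge0// exprn_ge0// expR_ge0.
rewrite -expRM_natr => qN.
exists (expR (- l * N%:R) *: (l^-1 *: g)); last first.
  by rewrite normrZ gtr0_norm ?expR_gt0.
have := bd N%:R (ler0n _ _); rewrite scalerBr => /vleBlD h.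
have : 0 <=v S g - l^-1 *: g + expR (- l * N%:R) *: (l^-1 *: g).
  apply: vle_trans h; apply: vle_scale; first exact: expR_ge0.
  by apply: T_pos => //; exact: Spos.
by rewrite addrAC => /vsub_ge0.
Qed.

End positive_resolvent.

(** * A subinvariant functional *)

Section subinvariant_functional.
Context {R : realType} {E : banachLatticeType R}.
Variable T : R -> {linear E -> E}.
Hypothesis T_C0 : C0_semigroup T.
Hypothesis T_pos : positive_semigroup T.
Hypothesis T_Abel : Abel_bounded (complexify (generator T)).
Implicit Types (x y z g : E) (t s l : R) (S : {linear E -> E}).
Let A := generator T.

(** The functional is dominated by the limit superior [p] of the norms of
    [(l S x)^+] as [l -> 0+].  It is positive because [p (- x) <= 0] for
    [x >= 0], and it vanishes on the range of the generator because [l S A x]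
    is [l (l S x - x)], which tends to 0. *)
Lemma subinvariant_functional g :
  0 <=v g -> g != 0 -> (forall t, 0 <= t -> g <=v T t g) ->
  exists f : {scalar E},
    [/\ forall x, 0 <=v x -> 0 <= f x,
        forall t x, 0 <= t -> 0 <=v x -> f (T t x) <= f x,
        0 < f g
      & exists2 M : R, 0 < M & forall x, f x <= M * `|x|].
Proof.
move=> g0 gn0 hg.
have [M M1 hM] := Abel_bounded_real T_Abel.
have M0 : 0 < M := lt_le_trans ltr01 M1.
(* a sequence of resolvent parameters decreasing to 0 *)
pose lam (k : nat) : R := k.+1%:R^-1.
have lam0 k : 0 < lam k by rewrite invr_gt0.
have hex k : exists F : {linear E -> E}, real_resolvent A (lam k) F /\
    forall x, `|lam k *: F x| <= M * `|x|.
  by have [F F1 F2] := hM _ (lam0 k); exists F.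
have [S hS] := choice hex.
have Sres k : real_resolvent A (lam k) (S k) by have [] := hS k.
have SM k x : `|lam k *: S k x| <= M * `|x| by have [_] := hS k; apply.
have Spos k : positive_op (S k).
  exact: (resolvent_positive T_C0 T_pos M1 hM (lam0 k) (Sres k)).
pose q k x := `|vpos (lam k *: S k x)|.
have q_le k x : q k x <= M * `|x| by apply: le_trans (vnorm_pos _) _.
have qD k x y : q k (x + y) <= q k x + q k y.
  rewrite /q linearD scalerDr; apply: le_trans (ler_normD _ _).
  by apply: vnorm_mono; [exact: vpos_ge0|exact: vposD].
have qZ k (a : R) x : 0 <= a -> q k (a *: x) = a * q k x.
  move=> a0; rewrite /q linearZ /= scalerA mulrC -scalerA vposZ//.
  by rewrite normrZ ger0_norm.
have q_neg k x : 0 <=v x -> q k (- x) = 0.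
  move=> x0; rewrite /q vpos_eq0 ?normr0// linearN scalerN; apply: voppr_le0.
  by apply: vle_scale; [exact: ltW|exact: Spos].
have q_g k : `|g| <= q k g.
  rewrite /q vpos_id; last by apply: vle_scale; [exact: ltW|exact: Spos].
  apply: vnorm_mono => //.
  exact: (resolvent_superharmonic T_C0 T_pos (lam0 k) (Sres k) (Spos k)).
pose Q n x := sup [set q k x | k in [set k | (n <= k)%N]].
have Qub n x : has_ubound [set q k x | k in [set k | (n <= k)%N]].
  by exists (M * `|x|) => _ [k _ <-].
have qQ n k x : (n <= k)%N -> q k x <= Q n x.
  by move=> nk; apply: ub_le_sup => //; exists k.
have Qle n x r : (forall k, (n <= k)%N -> q k x <= r) -> Q n x <= r.
  move=> h; apply: ge_sup; first by exists (q n x), n => /=.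
  by move=> _ [k /= nk <-]; exact: h.
have Q0 n x : 0 <= Q n x by apply: le_trans (qQ n n x (leqnn n)); exact: normr_ge0.
pose p x := inf [set Q n x | n in [set: nat]].
have pQ n x : p x <= Q n x.
  by apply: ge_inf; [exists 0 => _ [k _ <-]|exists n].
have p_sub : sublinear p.
  apply: (@sublinear_inf _ _ _ _ _ (fun=> 0)) => //.
  - by move=> n x _; rewrite oppr0.
  - move=> i j x y _ _; exists (maxn i j) => //; apply: Qle => k.
    rewrite geq_max => /andP[ik jk]; apply: le_trans (qD _ _ _) _.
    by apply: lerD; exact: qQ.
  - move=> i a x _ a0; exists i => //; apply: Qle => k ik.
    by rewrite qZ ?(ltW a0)// ler_pM2l//; exact: qQ.
  - move=> i _; apply: Qle => k _; rewrite -(scale0r (0 : E)) qZ// mul0r.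
    exact: lexx.
have [f fp fg] := hahn_banach g p_sub.
have f_pos x : 0 <=v x -> 0 <= f x.
  move=> x0; rewrite -oppr_le0 -linearN; apply: le_trans (fp _) _.
  by apply: le_trans (pQ 0%N _) _; apply: Qle => k _; rewrite q_neg.
have f_ker_le x : dom A x -> f (A x) <= 0 /\ - f (A x) <= 0.
  move=> dx.
  have SA k : lam k *: S k (A x) = lam k *: (lam k *: S k x - x).
    have := (Sres k).2 x dx; rewrite linearB linearZ /= => h; congr (_ *: _).
    by rewrite -[X in _ = _ - X]h opprB addrC subrK.
  have SAn k : `|lam k *: S k (A x)| <= lam k * ((M + 1) * `|x|).
    rewrite SA normrZ gtr0_norm// ler_pM2l//.
    by apply: le_trans (ler_normB _ _) _; rewrite mulrDl mul1r lerD2r.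
  have small (y : E) : (forall k, q k y <= lam k * ((M + 1) * `|x|)) -> p y <= 0.
    move=> hy; apply/ler_addgt0Pl => e e0; rewrite addr0.
    pose c := (M + 1) * `|x|.
    have c0 : 0 <= c by rewrite mulr_ge0// addr_ge0// ltW.
    have ec0 : 0 < e / (c + 1) by rewrite divr_gt0// ltr_wpDl.
    have [N _ hN] := near_infty_natSinv_lt (PosNum ec0).
    apply: le_trans (pQ N _) _; apply: Qle => k Nk.
    apply: le_trans (hy k) _; have /ltW lk := hN k Nk.
    apply: le_trans (ler_wpM2r c0 lk) _.
    rewrite /= mulrAC ler_pdivrMr ?ltr_wpDl// ler_pM2l// lerDl//.
  split; first by apply: le_trans (fp _) _; apply: small => k;
    apply: le_trans (vnorm_pos _) _.
  rewrite -linearN; apply: le_trans (fp _) _; apply: small => k.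
  by apply: le_trans (vnorm_pos _) _; rewrite linearN scalerN normrN.
have f_ker x : dom A x -> f (A x) = 0.
  by move=> /f_ker_le[h1 h2]; apply/eqP; rewrite eq_le h1 -oppr_le0.
(* f kills the range of the generator, so lam S acts as the identity under f *)
have f_res k x : lam k * f (S k x) = f x.
  have [dx hx] := (Sres k).1 x.
  by rewrite -[in RHS]hx linearB linearZ /= f_ker// subr0.
exists f; split => //.
- move=> t x t0 x0.
  have h k : expR (- lam k * t) * f (T t x) <= f x.
    rewrite -(f_res k x) -(f_res k (T t x)) mulrCA ler_pM2l//.
    rewrite (resolvent_orbit T_C0 x t0 (Sres k)) -subr_ge0.
    have /vsub_ge0/f_pos := resolvent_orbit_le T_C0 T_pos (lam0 k) (Sres k) t0 x0.
    by rewrite linearB linearZ.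
  have ft0 : 0 <= f (T t x) by apply: f_pos; exact: T_pos.
  apply/ler_addgt0Pl => e e0.
  pose c := t * f (T t x).
  have c0 : 0 <= c by rewrite mulr_ge0.
  have ec0 : 0 < e / (c + 1) by rewrite divr_gt0// ltr_wpDl.
  have [N _ hN] := near_infty_natSinv_lt (PosNum ec0).
  rewrite addrC -lerBlDr; apply: le_trans (h N).
  apply: (@le_trans _ _ ((1 + - lam N * t) * f (T t x))); last first.
    by apply: ler_wpM2r => //; exact: expR_ge1Dx.
  rewrite mulrDl mul1r lerD2l mulNr mulNr lerN2 -mulrA -/c.
  have /ltW lk := hN N (leqnn N).
  apply: le_trans (ler_wpM2r c0 lk) _.
  by rewrite /= mulrAC ler_pdivrMr ?ltr_wpDl// ler_pM2l// lerDl.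
- rewrite fg; apply: lt_le_trans (_ : `|g| <= _); first by rewrite normr_gt0.
  apply: lb_le_inf; first by exists (Q 0%N g), 0%N.
  by move=> _ [n _ <-]; apply: le_trans (qQ n n g (leqnn n)).
- exists M => // x; apply: le_trans (fp _) _; apply: le_trans (pQ 0%N _) _.
  by apply: Qle => k _; exact: q_le.
Qed.

End subinvariant_functional.

(** * Consequences of irreducibility *)

Section irreducibility.
Context {R : realType} {E : banachLatticeType R}.
Implicit Types (x y z g : E) (t s : R).

Lemma functional_mono (f : {scalar E}) x y :
  (forall z, 0 <=v z -> 0 <= f z) -> x <=v y -> f x <= f y.
Proof. by move=> f0 /vsub_ge0/f0; rewrite linearB subr_ge0. Qed.

Lemma positive_op_abs (S : {linear E -> E}) x :
  positive_op S -> vabs (S x) <=v S (vabs x).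
Proof.
move=> S0; apply: vabs_le; first by apply: positive_op_mono => //; exact: vabs_ge.
by rewrite -linearN; apply: positive_op_mono => //; exact: vabs_geN.
Qed.

Lemma closed_eps (J : set E) :
  (forall x, (forall e : R, 0 < e -> exists2 y, J y & `|x - y| < e) -> J x) ->
  closed J.
Proof.
move=> h x Jx; apply: h => e e0.
have [y [Jy]] := Jx _ (nbhsx_ballx x _ e0).
by rewrite -ball_normE /= => xy; exists y.
Qed.

(** The null ideal of [f] is closed, invariant and does not contain [g]. *)
Lemma functional_strictly_positive (T : R -> {linear E -> E}) (f : {scalar E})
    (M : R) g :
  positive_semigroup T -> irreducible_semigroup T ->
  (forall x, 0 <=v x -> 0 <= f x) ->
  (forall t x, 0 <= t -> 0 <=v x -> f (T t x) <= f x) ->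
  0 < M -> (forall x, f x <= M * `|x|) -> 0 <=v g -> 0 < f g ->
  forall x, 0 <=v x -> f x = 0 -> x = 0.
Proof.
move=> T_pos T_irr f0 fT M0 fM g0 fg.
pose J := [set x : E | f (vabs x) <= 0].
have fmono := functional_mono f0.
have [|||JE|JE] := T_irr J.
- apply: closed_eps => x hx; apply/ler_addgt0Pl => e e0; rewrite addr0.
  have [y Jy xy] := hx (e / M) (divr_gt0 e0 M0).
  rewrite -(subrKC y x).
  apply: le_trans (fmono _ _ (vabsD _ _)) _; rewrite linearD /=.
  rewrite -[e]add0r; apply: lerD => //; apply: le_trans (fM _) _.
  by rewrite vnorm_abs mulrC -ler_pdivlMr// ltW.
- split.
  + by rewrite /J /= vabs_id ?linear0//; exact: vle_refl.
  + move=> x y Jx Jy; apply: le_trans (fmono _ _ (vabsD _ _)) _.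
    by rewrite linearD -[leRHS]addr0; apply: lerD.
  + move=> a x Jx; apply: le_trans (fmono _ _ (vabsZ_le _ _)) _.
    by rewrite linearZ /=; apply: mulr_ge0_le0.
  + by move=> x y Jy /fmono/le_trans; apply.
- move=> t t0 x Jx; apply: le_trans (fmono _ _ (positive_op_abs _ (T_pos t t0))) _.
  by apply: le_trans (fT _ _ t0 (vabs_ge0 _)) _.
- move=> x x0 fx; have : J x by rewrite /J /= vabs_id// fx.
  by rewrite JE.
- have : J g by rewrite JE.
  by rewrite /J /= vabs_id// leNgt fg.
Qed.

(** The closure of the ideal generated by [g] is invariant and contains [g].
    It is described here through the distance of [|x|] to the intervals
    [[0, n g]], which makes it visibly solid and closed. *)
Lemma fixed_vector_quasi_interior (T : R -> {linear E -> E}) g :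
  C0_semigroup T -> positive_semigroup T -> irreducible_semigroup T ->
  0 <=v g -> g != 0 -> (forall t, 0 <= t -> T t g = g) ->
  forall x (e : R), 0 <=v x -> 0 < e -> exists n : nat, `|vpos (x - n%:R *: g)| <= e.
Proof.
move=> T_C0 T_pos T_irr g0 gn0 Tg.
pose J := [set x : E | forall e : R, 0 < e ->
  exists n : nat, `|vpos (vabs x - n%:R *: g)| <= e].
suff JE : J = setT.
  move=> x e x0 e0; have Jx : J x by rewrite JE.
  by have [n] := Jx _ e0; rewrite vabs_id// => hn; exists n.
have cmp u v r (e : R) : `|u| <= e -> 0 <=v v -> v <=v u -> `|v| <= e.
  by move=> ue v0 vu; apply: le_trans ue; exact: vnorm_mono.
have [|||JE|//] := T_irr J.
- apply: closed_eps => x hx e e0; have e20 : 0 < e / 2 by rewrite divr_gt0.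
  have [y Jy xy] := hx _ e20; have [n hn] := Jy _ e20; exists n.
  apply: (@le_trans _ _ `|vpos (vabs y - n%:R *: g) + vabs (x - y)|).
    apply: vnorm_mono; first exact: vpos_ge0.
    apply: vpos_le; last by apply: vaddr_ge0; [exact: vpos_ge0|exact: vabs_ge0].
    apply: (@vle_trans _ _ ((vabs y - n%:R *: g) + vabs (x - y))); last first.
      by apply: vle_add2r; exact: vle_pos.
    rewrite addrAC; apply: vle_add2r; rewrite -{1}(subrKC y x).
    exact: vabsD.
  apply: le_trans (ler_normD _ _) _; rewrite [e]splitr; apply: lerD => //.
  by rewrite vnorm_abs ltW.
- split.
  + move=> e e0; exists 0%N; rewrite scale0r subr0 vabs_id ?vpos_id ?normr0 ?ltW//;
      exact: vle_refl.
  + move=> x y Jx Jy e e0; have e20 : 0 < e / 2 by rewrite divr_gt0.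
    have [[n hn] [m hm]] := (Jx _ e20, Jy _ e20); exists (n + m)%N.
    apply: (@le_trans _ _ `|vpos (vabs x - n%:R *: g) + vpos (vabs y - m%:R *: g)|).
      apply: vnorm_mono; first exact: vpos_ge0.
      apply: (vle_trans _ (vposD _ _)); apply: vpos_mono.
      rewrite natrD scalerDl opprD addrACA; apply: vle_add2r; exact: vabsD.
    by apply: le_trans (ler_normD _ _) _; rewrite [e]splitr; apply: lerD.
  + move=> a x Jx e e0.
    have a1 : 0 < `|a| + 1 by rewrite ltr_wpDl.
    have [n hn] := Jx _ (divr_gt0 e0 a1).
    have [k hk] : exists k : nat, (`|a| + 1) * n%:R <= k%:R.
      by exists (Num.truncn ((`|a| + 1) * n%:R)).+1; rewrite ltW// truncnS_gt.
    exists k.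
    apply: (@le_trans _ _ `|(`|a| + 1) *: vpos (vabs x - n%:R *: g)|).
      apply: vnorm_mono; first exact: vpos_ge0.
      rewrite -vposZ ?ltW//; apply: vpos_mono; rewrite scalerBr scalerA.
      apply: vleD; last by apply: vleN2; exact: vleZr.
      apply: (vle_trans (vabsZ_le _ _)); apply: vleZr; last exact: vabs_ge0.
      by rewrite lerDl.
    by rewrite normrZ gtr0_norm// mulrC -ler_pdivlMr.
  + move=> x y Jy xy e e0; have [n hn] := Jy _ e0; exists n.
    apply: le_trans hn; apply: vnorm_mono; first exact: vpos_ge0.
    by apply: vpos_mono; exact: vle_add2r.
- move=> t t0 x Jx e e0; have [/(_ t t0) Tc _ _ _] := T_C0.
  have [C C0 hC] := linear_continuous_bound Tc.
  have [n hn] := Jx _ (divr_gt0 e0 C0); exists n.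
  apply: (@le_trans _ _ `|T t (vpos (vabs x - n%:R *: g))|).
    apply: vnorm_mono; first exact: vpos_ge0.
    apply: vpos_le; last by apply: T_pos => //; exact: vpos_ge0.
    apply: (@vle_trans _ _ (T t (vabs x - n%:R *: g))).
      rewrite (linearB (T t)) (linearZ_LR (T t)) /= Tg//; apply: vle_add2r.
      exact/positive_op_abs/T_pos.
    by apply: positive_op_mono; [exact: T_pos|exact: vle_pos].
  by apply: le_trans (hC _) _; rewrite mulrC -ler_pdivlMr.
- exfalso; have : J g.
    move=> e e0; exists 1%N; rewrite scale1r vabs_id// subrr vpos_id ?normr0 ?ltW//.
    exact: vle_refl.
  by rewrite JE /= => /eqP; rewrite (negPf gn0).
Qed.

(** Otherwise there are [h n] in [[0, g]] with [f (h n) <= 2^-n] and norm at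
    least [e].  The suprema of the tails decrease and have [f]-values at most
    [2^(1 - n)], so they decrease to 0, and order continuity of the norm makes
    the [h n] small. *)
Lemma functional_controls_norm (f : {scalar E}) (M : R) g :
  order_continuous_norm E ->
  (forall x, 0 <=v x -> 0 <= f x) -> 0 < M -> (forall x, f x <= M * `|x|) ->
  (forall x, 0 <=v x -> f x = 0 -> x = 0) ->
  forall e : R, 0 < e -> exists2 d : R, 0 < d &
    forall h, 0 <=v h -> h <=v g -> f h <= d -> `|h| < e.
Proof.
move=> ocn f0 M0 fM fstrict e e0; have fmono := functional_mono f0.
apply: contrapT => H.
pose eps (n : nat) : R := 2^-1 ^+ n.
have eps0 n : 0 < eps n by rewrite exprn_gt0// invr_gt0.
have hex n : exists h, [/\ 0 <=v h, h <=v g, f h <= eps n & e <= `|h|].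
  apply: contrapT => nh; apply: H; exists (eps n) => // h h0 hg fh.
  by rewrite ltNge; apply/negP => eh; apply: nh; exists h.
have [h hh] := choice hex.
have h0 n : 0 <=v h n by have [] := hh n.
have hg n : h n <=v g by have [] := hh n.
have fh n : f (h n) <= eps n by have [] := hh n.
have g0 : 0 <=v g by exact: vle_trans (h0 0%N) (hg 0%N).
(* the join of 0 and h n, h (n + 1) up to h (n + m - 1) *)
pose s n := fix s m := if m is m'.+1 then vjoin (s m') (h (n + m')%N) else 0.
have s_ge0 n m : 0 <=v s n m.
  case: m => [|m]; first exact: vle_refl.
  by apply: vle_trans (h0 (n + m)%N) (vle_joinr _ _).
have s_le n m : s n m <=v g by elim: m => [//|m IH]; exact: vjoin_le.
have s_mono n m k : (m <= k)%N -> s n m <=v s n k.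
  move=> /subnKC <-; elim: (k - m)%N => [|j IH]; first by rewrite addn0; exact: vle_refl.
  by rewrite addnS; apply: (vle_trans IH); exact: vle_joinl.
have fs n m : f (s n m) + 2 * eps (n + m)%N <= 2 * eps n.
  elim: m => [|m IH]; first by rewrite linear0 add0r addn0.
  apply: le_trans IH.
  have joinD : f (s n m.+1) <= f (s n m) + eps (n + m)%N.
    apply: le_trans (lerD (lexx _) (fh _)); rewrite -linearD; apply: fmono.
    apply: vjoin_le; first by apply: vle_addr.
    by apply: vle_addl.
  apply: le_trans (lerD joinD (lexx _)) _; rewrite -addrA lerD2l.
  rewrite addnS /eps exprS [X in _ + X <= _]mulrA mulfV ?pnatr_eq0// mul1r.
  by rewrite [leRHS]mulr_natl.
(* eventual upper bounds stand in for the suprema of the tails *)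
pose D := [set d | exists n, forall k, (n <= k)%N -> h k <=v d].
have [|||d [n dn] hd] := ocn D _ _ _ e e0.
- by exists g, 0%N => k _.
- move=> x y [n xn] [m ym]; exists (vmeet x y); split; last 2 first.
    exact: vmeet_lel.
    exact: vmeet_ler.
  exists (maxn n m) => k; rewrite geq_max => /andP[nk mk].
  by apply: vmeet_ge; [exact: xn|exact: ym].
- split=> // [d [n dn]|w _ wD]; first exact: vle_trans (h0 n) (dn n (leqnn n)).
  have fw n : f (vpos w) <= 2 * eps n.
    have [|||m [_ mub ml] mapp] := @oc_directed_lub _ _ ocn [set s n k | k in setT] g.
    + by exists (s n 0%N), 0%N.
    + move=> _ _ [i _ <-] [j _ <-]; exists (s n (maxn i j)); split.
      * by exists (maxn i j).
      * by apply: s_mono; exact: leq_maxl.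
      * by apply: s_mono; exact: leq_maxr.
    + by move=> _ [k _ <-].
    have wm : w <=v m.
      apply: wD; exists n => k /subnKC <-.
      apply: (vle_trans (vle_joinr (s n (k - n)%N) _)).
      by apply: mub; exists (k - n).+1.
    have m0 : 0 <=v m by apply: (mub (s n 0%N)); exists 0%N.
    apply/ler_addgt0Pl => c c0.
    have [_ [k _ <-] mk] := mapp _ (divr_gt0 c0 M0).
    apply: le_trans (fmono _ m (vpos_le wm m0)) _.
    rewrite -(subrK (s n k) m) linearD; apply: lerD.
      by apply: le_trans (fM _) _; rewrite mulrC -ler_pdivlMr.
    apply: le_trans (fs n k); rewrite lerDl mulr_ge0// ltW//.
  have w0 : vpos w = 0.
    apply: fstrict; first exact: vpos_ge0.
    apply/eqP; rewrite eq_le f0 ?andbT; last exact: vpos_ge0.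
    apply/ler_addgt0Pl => c c0; rewrite addr0.
    have : (fun n => 2 * 2^-1 ^+ n) @ \oo --> (0 : R).
      rewrite -(mulr0 2); apply: cvgM; first exact: cvg_cst.
      by apply: cvg_expr; rewrite gtr0_norm ?invr_gt0// invf_lt1// ltr1n.
    move=> /cvgrPdist_le/(_ _ c0)[N _ /(_ N (leqnn N))].
    rewrite sub0r normrN ger0_norm; last by rewrite mulr_ge0// ltW// eps0.
    exact: le_trans (fw N).
  by rewrite -w0; exact: vle_pos.
have := hd d (ex_intro _ n dn) (vle_refl d); rewrite ltNge => /negP; apply.
have [_ _ _ eh] := hh n; apply: le_trans eh _; apply: vnorm_mono => //.
exact: dn.
Qed.

End irreducibility.

(** * The circle of phases and its humps *)

Section circle.
Context {R : realType} {E : banachLatticeType R}.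
Variables (a b : E).
Implicit Types (x y z w : E) (s t r d : R).

(** The real part of [exp (- i t) (a + i b)]. *)
Definition phase t : E := cos t *: a + sin t *: b.

Lemma phaseD2pi t : phase (t + pi *+ 2) = phase t.
Proof. by rewrite /phase cosD2pi sinD2pi. Qed.

Lemma phaseD2pin t n : phase (t + (pi *+ 2) *+ n) = phase t.
Proof.
elim: n => [|n IH]; first by rewrite mulr0n addr0.
by rewrite mulrSr addrA phaseD2pi.
Qed.

Lemma phaseDpi t : phase (t + pi) = - phase t.
Proof. by rewrite /phase cosDpi sinDpi !scaleNr opprD. Qed.

Lemma phaseD s t : phase s + phase t = (2 * cos ((s - t) / 2)) *: phase ((s + t) / 2).
Proof.
have h p q : phase (p + q) + phase (p - q) = (2 * cos q) *: phase p.
  rewrite /phase addrACA -!scalerDl scalerDr !scalerA.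
  by rewrite !(cosB, sinB, cosD, sinD); congr (_ *: _ + _ *: _); ring.
by rewrite -h; congr (phase _ + phase _); field.
Qed.

Lemma phase_interpolation (u d r : R) :
  sin d *: phase (u + r) = sin (d - r) *: phase u + sin r *: phase (u + d).
Proof.
rewrite /phase !scalerDr !scalerA addrACA -!scalerDl.
by congr (_ *: _ + _ *: _); rewrite !(sinB, cosD, sinD); ring.
Qed.

(** An angle [u + r] between two consecutive division points [u] and [u + d]
    is a nonnegative combination of them with total weight
    [cos (d / 2 - r) / cos (d / 2)], which is at most [1 / cos (d / 2)]. *)
Lemma phase_cover d w : 0 < d -> d <= pi / 2 -> 0 <=v w ->
  (forall j : nat, phase (d * j%:R) <=v w) ->
  forall t, cos (d / 2) *: phase t <=v w.
Proof.
move=> d0 dpi w0 hw.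
have pi0 : 0 < pi :> R := pi_gt0 R.
have pi20 : 0 < pi *+ 2 :> R by rewrite mulr2n addr_gt0.
have pos t : 0 <= t -> cos (d / 2) *: phase t <=v w.
  move=> t0; pose j := Num.truncn (t / d); pose r := t - d * j%:R.
  have /andP[j1 j2] : j%:R <= t / d < j.+1%:R.
    by apply: truncn_itv; rewrite divr_ge0// ltW.
  have r0 : 0 <= r by rewrite subr_ge0 mulrC -ler_pdivlMr.
  have rd : r <= d.
    rewrite lerBlDr -[X in X + _]mulr1 -mulrDr addrC natr1 mulrC.
    by rewrite -ler_pdivrMr// ltW.
  have -> : t = d * j%:R + r by rewrite /r addrC subrK.
  have s2 : 0 < sin (d / 2) by apply: sin_gt0_pi; lra.
  have sr : 0 <= sin r by apply: sin_ge0_pi; lra.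
  have sdr : 0 <= sin (d - r) by apply: sin_ge0_pi; lra.
  have s20 : 0 < 2 * sin (d / 2) by rewrite mulr_gt0.
  apply: (vleZK s20); rewrite scalerA.
  have -> : 2 * sin (d / 2) * cos (d / 2) = sin d.
    have dE : d = (d / 2) *+ 2 by rewrite -mulr_natr; field.
    by rewrite [in RHS]dE sin_mulr2n -mulr_natr; ring.
  rewrite phase_interpolation.
  have -> : d * j%:R + d = d * j.+1%:R by rewrite -natr1 mulrDr mulr1.
  apply: (@vle_trans _ _ ((sin (d - r) + sin r) *: w)).
    by rewrite scalerDl; apply: vleD; apply: vleZ.
  apply: vleZr => //.
  have h (p q : R) : sin (p + q) + sin (p - q) = 2 * sin p * cos q.
    by rewrite sinB sinD; ring.
  have -> : sin (d - r) + sin r = 2 * sin (d / 2) * cos (d / 2 - r).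
    by rewrite -h; congr (sin _ + sin _); field.
  by rewrite ler_piMr ?cos_le1// ltW.
move=> t; have [n tn] : exists n : nat, 0 <= t + (pi *+ 2) *+ n.
  exists (Num.truncn (`|t| / (pi *+ 2))).+1.
  rewrite -[(pi *+ 2) *+ _]mulr_natl -lerBlDl sub0r.
  apply: le_trans (ler_norm _) _; rewrite normrN -ler_pdivrMr//.
  by rewrite ltW// truncnS_gt.
by rewrite -(phaseD2pin t n); exact: pos.
Qed.

End circle.

Section humps.
Context {R : realType} {E : banachLatticeType R}.
Variables (a b e : E).
Hypothesis e_lub : is_lub vle setT [set phase a b t | t in [set: R]] e.
Variable n : nat.
Hypothesis n2 : (2 <= n)%N.
Implicit Types (x y z w : E) (s t r d : R).
Local Notation phase := (phase a b).

Let d : R := pi / n%:R.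
Let c := cos d.
Let k := cos (d / 2).

Lemma phase_le t : phase t <=v e.
Proof. by have [_ + _] := e_lub; apply; exists t. Qed.

Lemma phaseN_le t : - phase t <=v e.
Proof. by rewrite -phaseDpi; exact: phase_le. Qed.

Lemma modulus_ge0 : 0 <=v e.
Proof.
apply: (vle_trans (vabs_ge0 (phase 0))).
by apply: vabs_le; [exact: phase_le|exact: phaseN_le].
Qed.

Let n0 : 0 < n%:R :> R. Proof. by rewrite ltr0n (leq_trans _ n2). Qed.

Let d0 : 0 < d. Proof. by rewrite divr_gt0// pi_gt0. Qed.

Let dpi : d <= pi / 2.
Proof.
by rewrite /d ler_pM2l ?pi_gt0// lef_pV2 ?posrE// ler_nat.
Qed.

Let c0 : 0 <= c.
Proof.
have := pi_gt0 R; have := d0; have := dpi => h1 h2 h3.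
by apply: cos_ge0_pihalf; apply/andP; split => //; lra.
Qed.

Lemma cos_gap : 0 < k - c.
Proof.
have := pi_gt0 R; have := d0; have := dpi => h1 h2 h3.
by rewrite subr_gt0 ltr_cos ?in_itv/=; [lra|apply/andP; split; lra..].
Qed.

Let kc := cos_gap.

Let k01 : 0 <= k <= 1.
Proof.
by rewrite cos_le1 andbT; apply: le_trans c0 _; rewrite -subr_ge0 ltW// kc.
Qed.

Let c_k : c = 2 * k ^+ 2 - 1.
Proof.
rewrite /c; have -> : d = (d / 2) *+ 2 by rewrite -mulr_natr; field.
by rewrite cos_mulr2n -mulr_natl.
Qed.

(** The truncation level [c = cos d] confines it to an arc of radius
    [d = pi / n], and the factor lets it reach [e] within [d / 2] of [t]. *)
Definition hump t : E := (k - c)^-1 *: vpos (phase t - c *: e).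

Lemma hump_ge0 t : 0 <=v hump t.
Proof. by apply: vle_scale; [rewrite invr_ge0 ltW|exact: vpos_ge0]. Qed.

Lemma humpK t : (k - c) *: hump t = vpos (phase t - c *: e).
Proof. by rewrite /hump scalerA mulfV ?gt_eqF// scale1r. Qed.

(** As [c = 2 k^2 - 1], the inequality [1 - c <= 2 (k - c)] amounts to
    [k^2 <= k]. *)
Lemma hump_le t : hump t <=v 2 *: e.
Proof.
apply: (vleZK kc); rewrite humpK scalerA.
apply: (@vle_trans _ _ ((1 - c) *: e)).
  apply: vpos_le.
    by rewrite scalerBl scale1r; apply: vle_add2r; exact: phase_le.
  by apply: vle_scale modulus_ge0; rewrite subr_ge0 cos_le1.
apply: vleZr modulus_ge0.
have /andP[k0 k1] := k01; rewrite c_k; nra.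
Qed.

(** The sum of two phases is [2 cos (s / 2)] times a phase, where [s] is the
    angle between them.  If the angle is at least [2 d] on both sides, this is
    at most [2 c e], so one truncated phase is at most minus the other. *)
Lemma hump_disjoint t i j : (i < j < n)%N ->
  vmeet (hump (t + 2 * d * i%:R)) (hump (t + 2 * d * j%:R)) = 0.
Proof.
move=> /andP[ij jn]; rewrite /hump.
apply: vmeetZ_eq0; [by rewrite invr_ge0 ltW|exact: vpos_ge0|exact: vpos_ge0|].
set p := phase _ - _; set q := phase _ - _.
apply: vle_anti; last by apply: vmeet_ge; exact: vpos_ge0.
rewrite -(vpos_disjoint p); apply: vmeet_mono; first exact: vle_refl.
apply: vpos_mono; rewrite -[q](addKr p) -[X in _ <=v X]addr0; apply: vle_add2l.
rewrite /p /q addrACA phaseD -opprD -scalerDl; apply/vleBlD; rewrite add0r.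
rewrite -mulr2n -[c *+ 2]mulr_natl -!scalerA; apply: vleZ => //.
have -> : (t + 2 * d * i%:R - (t + 2 * d * j%:R)) / 2 = - (d * (j - i)%:R).
  by rewrite natrB ?(ltnW ij)//; field.
rewrite cosN; set g := cos _.
have pi0 := pi_gt0 R.
have dn : d * n%:R = pi by rewrite /d divfK// gt_eqF.
have m1 : (1 : R) <= (j - i)%:R by rewrite ler1n subn_gt0.
have mn : (j - i)%:R + 1 <= n%:R :> R.
  by rewrite natr1 ler_nat (leq_ltn_trans (leq_subr _ _)).
have dm1 : d <= d * (j - i)%:R by rewrite ler_peMr// ltW.
have dmn : d * (j - i)%:R <= pi - d by rewrite -dn lerBrDr -[X in _ + X]mulr1 -mulrDr ler_pM2l.
have gc : `|g| <= c.
  have cos_le (x y : R) : 0 <= x -> x <= y -> y <= pi -> cos y <= cos x.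
    move=> x0; rewrite le_eqVlt => /predU1P[->//|xy] yp.
    by rewrite ltW// ltr_cos ?in_itv//=; apply/andP; split; lra.
  have d0' := d0; have h := dpi.
  have -> : (`|g| <= c) = (cos (pi - d) <= g <= c).
    by rewrite ler_norml cosB cospi sinpi mul0r addr0 mulN1r.
  by apply/andP; split; apply: cos_le => //; lra.
apply: (@vle_trans _ _ (`|g| *: e)); last exact: vleZr modulus_ge0.
have [g0|g0] := leP 0 g.
  by rewrite ger0_norm//; apply: vleZ => //; exact: phase_le.
rewrite ltr0_norm// -[g *: _]opprK -scalerN -scaleNr.
by apply: vleZ; [rewrite oppr_ge0 ltW|exact: phaseN_le].
Qed.

(** If [S] is the sum of the humps then all division points satisfy
    [phase <= c e + (k - c) S], and [phase_cover] gives
    [k e <= c e + (k - c) S]. *)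
Lemma hump_cover : e <=v
  \sum_(i < n) hump (0 + 2 * d * i%:R) + \sum_(i < n) hump (d + 2 * d * i%:R).
Proof.
set S := _ + _.
have Sb j : hump (d * j%:R) <=v S.
  have term t i : (i < n)%N ->
      hump (t + 2 * d * i%:R) <=v \sum_(i < n) hump (t + 2 * d * i%:R).
    move=> ni; rewrite (bigD1 (Ordinal ni))//=; apply: vle_addr.
    elim/big_ind: _ => //; [exact: vle_refl|exact: vaddr_ge0|].
    by move=> *; exact: hump_ge0.
  have dn : d * n%:R = pi by rewrite /d divfK// gt_eqF.
  (* n * d = pi, so only the residue of j modulo 2 n matters; its parity
     decides between the two sums. *)
  pose r := (j %% (2 * n))%N; pose q := (j %/ (2 * n))%N.
  have jE : (j = q * (2 * n) + r)%N by exact: divn_eq.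
  have -> : hump (d * j%:R) = hump (d * r%:R).
    rewrite /hump -[in RHS](phaseD2pin _ _ _ q); congr (_ *: vpos (phase _ - _)).
    rewrite jE natrD mulrDr addrC; congr (_ + _).
    by rewrite !natrM -[RHS]mulr_natl -[pi *+ 2]mulr_natl -dn; ring.
  have rn : (r < 2 * n)%N by rewrite ltn_mod muln_gt0 (leq_trans _ n2).
  have rE : (r = odd r + r./2.*2)%N by rewrite odd_double_half.
  have r2n : (r./2 < n)%N by rewrite ltn_half_double -mul2n.
  have r2E : r%:R = (odd r)%:R + 2 * (r./2)%:R :> R.
    by rewrite {1}rE natrD -mul2n natrM.
  case: (odd r) r2E => r2E.
    have {}r2E : r%:R = 1 + 2 * (r./2)%:R :> R := r2E.
    apply: vle_trans (_ : \sum_(i < n) hump (d + 2 * d * i%:R) <=v _).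
      have -> : d * r%:R = d + 2 * d * r./2%:R by rewrite r2E; ring.
      exact: term.
    by apply: vle_addl; apply: vsum_ge0 => i; exact: hump_ge0.
  have {}r2E : r%:R = 0 + 2 * (r./2)%:R :> R := r2E.
  apply: vle_trans (_ : \sum_(i < n) hump (0 + 2 * d * i%:R) <=v _).
    have -> : d * r%:R = 0 + 2 * d * r./2%:R by rewrite r2E; ring.
    exact: term.
  by apply: vle_addr; apply: vsum_ge0 => i; exact: hump_ge0.
have S0 : 0 <=v S by apply: vaddr_ge0; apply: vsum_ge0 => i; exact: hump_ge0.
pose w := c *: e + (k - c) *: S.
have w0 : 0 <=v w.
  apply: vaddr_ge0; first by apply: vle_scale => //; exact: modulus_ge0.
  by apply: vle_scale S0; exact: ltW.
have rw (j : nat) : phase (d * j%:R) <=v w.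
  rewrite /w addrC; apply/vleBlD; apply: vle_trans (vle_pos _) _.
  by rewrite -humpK; apply: vleZ; [exact: ltW|exact: Sb].
have cover := phase_cover d0 dpi w0 rw.
have k0 : 0 < k by rewrite -subr_gt0 (lt_le_trans kc)// lerD2l lerN2.
have ke : k *: e <=v w.
  have [_ _ le] := e_lub.
  have ki : 0 < k^-1 by rewrite invr_gt0.
  apply: (vleZK ki); rewrite scalerA mulVf ?gt_eqF// scale1r.
  apply: le => // _ [t _ <-]; apply: (vleZK k0).
  by rewrite scalerA mulfV ?gt_eqF// scale1r; exact: cover.
apply: (vleZK kc); rewrite scalerBl; apply/vleBlD.
by rewrite addrC.
Qed.

End humps.

(** * Disjointness from finite rank operators *)

Section finite_rank_operators.
Context {R : realType} {E : banachLatticeType R}.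
Implicit Types (x y z w : E).

Lemma vabs_sum_ge n (u : 'I_n -> E) i : vabs (u i) <=v \sum_(j < n) vabs (u j).
Proof.
rewrite (bigD1 i)//=; apply: vle_addr.
by elim/big_ind: _ => //; [exact: vle_refl|exact: vaddr_ge0|move=> *; exact: vabs_ge0].
Qed.

(** [u] is the sum of the moduli of the vectors spanning the range, and [C] is
    the sum of the norms of the coordinate functionals. *)
Lemma finite_rank_dominated (K : E -> E) : finite_rank K ->
  exists (L : {linear E -> E}) (C : R) (u : E),
    [/\ K = L, 0 <= C, 0 <=v u & forall y, L y <=v (C * `|y|) *: u].
Proof.
move=> [n [phi [u [phic KE]]]].
have hC i : exists C : R, 0 < C /\ forall x, `|phi i x| <= C * `|x|.
  have [C C0 hC] := @linear_continuous_bound R E R^o (phi i) (phic i).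
  by exists C.
have [C /all_and2[C0 hC']] := choice hC.
pose k x := \sum_(i < n) phi i x *: u i.
have k_lin : linear k.
  move=> a x y; rewrite /k scaler_sumr -big_split/=; apply: eq_bigr => i _.
  by rewrite linearP scalerDl scalerA.
exists (HB.pack k (GRing.isLinear.Build R E E *:%R k k_lin) : {linear E -> E}).
exists (\sum_(i < n) C i), (\sum_(i < n) vabs (u i)); split => //.
- exact: funext.
- by apply: sumr_ge0 => i _; exact: ltW.
- by apply: vsum_ge0 => i; exact: vabs_ge0.
move=> y; rewrite mulr_suml scaler_suml; apply: vle_sum => i.
apply: (vle_trans (vabs_ge _)); apply: (vle_trans (vabsZ_le _ _)).
apply: (@vle_trans _ _ ((C i * `|y|) *: vabs (u i))).
  by apply: vleZr; [exact: hC'|exact: vabs_ge0].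
apply: vleZ; first by rewrite mulr_ge0// ltW.
exact: vabs_sum_ge.
Qed.

Lemma positive_op_regular (S : {linear E -> E}) : positive_op S -> regular_op S.
Proof.
move=> S0; exists S, \0; split=> //; first by move=> x _; exact: vle_refl.
by move=> x; rewrite subr0.
Qed.

Lemma positive_op_modulus (S : {linear E -> E}) : positive_op S -> op_modulus S S.
Proof.
move=> S0; split; first exact: positive_op_regular.
- move=> _ [->|->] x x0; first exact: vle_refl.
  by apply: (vle_trans (voppr_le0 (S0 x x0))); exact: S0.
- by move=> U _ Uub; apply: Uub; left.
Qed.

Lemma regular_op_sum (L : E -> E) n (z : 'I_n -> E) : regular_op L ->
  L (\sum_(i < n) z i) = \sum_(i < n) L (z i).
Proof.
move=> [P [Q [_ _ LE]]]; rewrite LE (linear_sum P) (linear_sum Q) -sumrB.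
by apply: eq_bigr => i _; rewrite LE.
Qed.

End finite_rank_operators.

Section peripheral_eigenvalue.
Context {R : realType} {E : banachLatticeType R}.
Variable T : R -> {linear E -> E}.
Hypothesis ocn : order_continuous_norm E.
Hypothesis T_C0 : C0_semigroup T.
Hypothesis T_pos : positive_semigroup T.
Hypothesis T_irr : irreducible_semigroup T.
Hypothesis T_Abel : Abel_bounded (complexify (generator T)).
Let A := generator T.
Variables (a b : E) (al : R).
Hypotheses (a_dom : dom A a) (b_dom : dom A b).
Hypotheses (Aa : A a = - al *: b) (Ab : A b = al *: a).
Hypotheses (al0 : al != 0) (ab0 : a != 0 \/ b != 0).
Local Notation phase := (phase a b).
Implicit Types (x y z w : E) (s t : R).

(** The right derivative of the left-hand side in [s] vanishes. *)
Lemma phase_unwind t s : 0 <= s -> T s (phase (t + al * s)) = phase t.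
Proof.
pose G s := cos (t + al * s) *: T s a + sin (t + al * s) *: T s b.
have GE r : T r (phase (t + al * r)) = G r by rewrite linearD !linearZ.
have cont (f : R -> R) : continuous f -> continuous (fun r => f (t + al * r)).
  move=> fc r; apply: continuous_comp; last exact: fc.
  by apply: cvgD; [exact: cvg_cst|apply: cvgM; [exact: cvg_cst|exact: cvg_id]].
have Gc : half_line_continuous G.
  apply: half_line_continuousD; apply: half_line_continuousZ.
  - exact/cont/continuous_cos.
  - exact: orbit_continuous.
  - exact/cont/continuous_sin.
  - exact: orbit_continuous.
have Gd r : 0 <= r -> right_derivative G r 0.
  move=> r0.
  have da := right_derivativeZ (is_derive_comp_affine (is_derive_cos (t + al * r)))
    (orbit_right_derivative T_C0 r0 a_dom).
  have db := right_derivativeZ (is_derive_comp_affine (is_derive_sin (t + al * r)))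
    (orbit_right_derivative T_C0 r0 b_dom).
  have := right_derivativeD da db.
  rewrite -/A Aa Ab !linearZ /= !scalerA.
  set u := cos _; set v := sin _; rewrite addrACA addrC.
  rewrite [(- al * u) *: _ + _]addrC addrACA -!scalerDl.
  have zero (x y : R) : x = 0 -> y = 0 -> x *: T r a + y *: T r b = 0.
    by move=> -> ->; rewrite !scale0r addr0.
  by rewrite zero //; [ring|rewrite subrr scale0r].
have G0 : G 0 = phase t by rewrite -GE mulr0 addr0; case: T_C0 => _ -> _ _.
move=> s0; rewrite GE -G0; apply: vle_anti.
  apply: right_derivative_le0 => // r r0; exists 0; [exact: Gd|exact: vle_refl].
have NGc : half_line_continuous (fun r => -1 *: G r).
  by apply: half_line_continuousZ => // r; exact: cvg_cst.
have NGd r : 0 <= r -> right_derivative (fun r => -1 *: G r) r 0.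
  move=> r0; have := right_derivativeZ (is_derive_cst (-1 : R) r (1 : R)) (Gd r r0).
  by rewrite scaler0 scale0r addr0.
have := right_derivative_le0 NGc _ s0; rewrite !scaleN1r => h.
rewrite -[G 0]opprK -[G s]opprK; apply/vleN2/h => r r0.
by exists 0; [exact: NGd|exact: vle_refl].
Qed.

Lemma orbit_phase t s : 0 <= s -> T s (phase t) = phase (t - al * s).
Proof. by move=> s0; rewrite -(phase_unwind (t - al * s) s0) subrK. Qed.

Lemma modulus_exists : exists e, is_lub vle setT [set phase t | t in [set: R]] e.
Proof.
apply: (@oc_lub _ _ ocn _ (vabs a + vabs b)); first by exists (phase 0), 0.
move=> _ [t _ <-]; apply: vleD; apply: (vle_trans (vabs_ge _));
  apply: (vle_trans (vabsZ_le _ _)); rewrite -[X in _ <=v X]scale1r;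
  by apply: vleZr; [rewrite ?cos_max ?sin_max|exact: vabs_ge0].
Qed.

Variable e : E.
Hypothesis e_lub : is_lub vle setT [set phase t | t in [set: R]] e.

Lemma modulus_neq0 : e != 0.
Proof.
apply/negP => /eqP e0; have r0 t : phase t = 0.
  by apply: vle_anti; rewrite -e0; [exact: (phase_le e_lub)|];
    rewrite -[phase t]opprK e0 -[0]oppr0 -{1}e0; apply: vleN2; exact: (phaseN_le e_lub).
have := r0 0; rewrite /phase cos0 sin0 scale1r scale0r addr0 => a0.
have := r0 (pi / 2); rewrite /phase cos_pihalf sin_pihalf scale1r scale0r add0r => b0'.
by case: ab0; rewrite ?a0 ?b0' eqxx.
Qed.

Lemma modulus_le_orbit t : 0 <= t -> e <=v T t e.
Proof.
move=> t0; have [_ _ le] := e_lub; apply: le => // _ [s _ <-].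
rewrite -(phase_unwind s t0); apply: positive_op_mono; first exact: T_pos.
exact: (phase_le e_lub).
Qed.

Lemma invariant_functional : exists (f : {scalar E}) (M : R),
  [/\ forall x, 0 <=v x -> 0 <= f x,
      forall t x, 0 <= t -> 0 <=v x -> f (T t x) <= f x,
      0 < M, forall x, f x <= M * `|x|
    & forall x, 0 <=v x -> f x = 0 -> x = 0].
Proof.
have [f [f0 fT fe [M M0 fM]]] := subinvariant_functional T_C0 T_pos T_Abel
  (modulus_ge0 e_lub) modulus_neq0 modulus_le_orbit.
exists f, M; split => //.
exact: (functional_strictly_positive T_pos T_irr f0 fT M0 fM (modulus_ge0 e_lub) fe).
Qed.

Variables (f : {scalar E}) (M : R).
Hypothesis f0 : forall x, 0 <=v x -> 0 <= f x.
Hypothesis fT : forall t x, 0 <= t -> 0 <=v x -> f (T t x) <= f x.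
Hypothesis M0 : 0 < M.
Hypothesis fM : forall x, f x <= M * `|x|.
Hypothesis f_strict : forall x, 0 <=v x -> f x = 0 -> x = 0.

(** Strict positivity turns an inequality of vectors on which [f] does not
    increase into an equality. *)
Lemma eq_of_le_functional x y : x <=v y -> f y <= f x -> x = y.
Proof.
move=> /vsub_ge0 xy fyx; apply/esym/eqP; rewrite -subr_eq0; apply/eqP.
apply: f_strict => //; apply/eqP; rewrite eq_le f0// andbT.
by rewrite linearB subr_le0.
Qed.

Lemma modulus_fixed t : 0 <= t -> T t e = e.
Proof.
move=> t0; apply/esym/eq_of_le_functional; first exact: modulus_le_orbit.
by apply: fT => //; exact: (modulus_ge0 e_lub).
Qed.

(** Full turns are added to make the time nonnegative; the sign of [al] decides
    to which side of the equation they go. *)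
Lemma exists_time t t' : exists s, 0 <= s /\
  (exists n : nat, t - al * s + (pi *+ 2) *+ n = t' \/
                   t - al * s = t' + (pi *+ 2) *+ n).
Proof.
have pi20 : 0 < pi *+ 2 :> R by rewrite mulr2n addr_gt0 ?pi_gt0.
pose n := (Num.truncn (`|t - t'| / (pi *+ 2))).+1.
have hn : `|t - t'| <= (pi *+ 2) *+ n.
  by rewrite -[X in _ <= X]mulr_natl -ler_pdivrMr// ltW// truncnS_gt.
have /andP[h1 h2] : - ((pi *+ 2) *+ n) <= t - t' <= (pi *+ 2) *+ n by rewrite -ler_norml.
have [alp|aln] := ltP 0 al.
  exists ((t - t' + (pi *+ 2) *+ n) / al); split.
    by rewrite divr_ge0// ?(ltW alp)//; rewrite -lerBlDr sub0r.
  exists n; left; rewrite mulrC divfK//; ring.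
exists ((t - t' - (pi *+ 2) *+ n) / al); split.
  by rewrite mulr_le0 ?invr_le0// subr_le0.
by exists n; right; rewrite mulrC divfK//; ring.
Qed.

(** [T s] maps the positive part for the angle [t] to something above the one
    for [t - al s], while [f] does not increase.  Since [al != 0], every
    angle is reached from every other, so the values of [f] are all equal. *)
Lemma level_functional_le (c t t' : R) :
  f (vpos (phase t' - c *: e)) <= f (vpos (phase t - c *: e)).
Proof.
have step s r : 0 <= s -> f (vpos (phase (r - al * s) - c *: e)) <= f (vpos (phase r - c *: e)).
  move=> s0; apply: le_trans (fT s0 (vpos_ge0 _)); apply: functional_mono => //.
  apply: vpos_le; last by apply: T_pos => //; exact: vpos_ge0.
  apply: (@vle_trans _ _ (T s (phase r - c *: e))).
    by rewrite (linearB (T s)) (linearZ_LR (T s)) /= modulus_fixed// orbit_phase//; exact: vle_refl.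
  by apply: positive_op_mono; [exact: T_pos|exact: vle_pos].
have [s [s0 [n [<-|h]]]] := exists_time t t'.
  by rewrite phaseD2pin; exact: step.
by rewrite -(phaseD2pin a b t' n) -h; exact: step.
Qed.

Lemma orbit_level (c t s : R) : 0 <= s ->
  T s (vpos (phase t - c *: e)) = vpos (phase (t - al * s) - c *: e).
Proof.
move=> s0; apply/esym/eq_of_le_functional.
  apply: vpos_le; last by apply: T_pos => //; exact: vpos_ge0.
  apply: (@vle_trans _ _ (T s (phase t - c *: e))).
    by rewrite (linearB (T s)) (linearZ_LR (T s)) /= modulus_fixed// orbit_phase//; exact: vle_refl.
  by apply: positive_op_mono; [exact: T_pos|exact: vle_pos].
apply: le_trans (fT s0 (vpos_ge0 _)) _; exact: level_functional_le.
Qed.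

Lemma orbit_hump n t s : 0 <= s ->
  T s (hump a b e n t) = hump a b e n (t - al * s).
Proof. by move=> s0; rewrite /hump linearZ /= orbit_level. Qed.

(** [n] disjoint humps of equal [f]-value fit under [2 e]. *)
Lemma hump_functional n t : (2 <= n)%N ->
  n%:R * f (hump a b e n t) <= f (2 *: e).
Proof.
move=> n2; set d : R := pi / n%:R.
have same t' : f (hump a b e n t) <= f (hump a b e n t').
  have fZ r x : f (r *: x) = r * f x by exact: linearZ.
  rewrite /hump !fZ; apply: ler_wpM2l; last exact: level_functional_le.
  by rewrite invr_ge0 ltW// cos_gap.
apply: (@le_trans _ _ (f (\sum_(i < n) hump a b e n (0 + 2 * d * i%:R)))).
  rewrite linear_sum mulr_natl -[X in _ *+ X]card_ord -sumr_const.
  by apply: ler_sum => i _; exact: same.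
apply: functional_mono => //.
apply: (disjoint_sum_le (y := fun i => hump a b e n (0 + 2 * d * i%:R))).
- by apply: vle_scale => //; exact: (modulus_ge0 e_lub).
- by move=> i _; split; [exact: hump_ge0|exact: hump_le].
- by move=> i j ij; exact: hump_disjoint.
Qed.

Lemma hump_norm_small (eps : R) : 0 < eps ->
  exists2 n : nat, (2 <= n)%N & forall t, `|hump a b e n t| < eps.
Proof.
move=> eps0.
have [d d0 hd] := functional_controls_norm (2 *: e) ocn f0 M0 fM f_strict eps0.
pose n := (Num.truncn (f (2 *: e) / d)).+2.
have n2 : (2 <= n)%N by [].
exists n => // t; apply: hd; [exact: hump_ge0|exact: hump_le|].
have n0 : 0 < n%:R :> R by rewrite ltr0n.
rewrite -(ler_pM2l n0); apply: le_trans (hump_functional t n2) _.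
rewrite -ler_pdivrMr// ltW//; apply: lt_trans (truncnS_gt _) _.
by rewrite ltr_nat.
Qed.

Section disjointness.
Variables (s C : R) (u : E) (N : {linear E -> E}) (L : E -> E).
Hypotheses (s0 : 0 <= s) (C0 : 0 <= C) (u0 : 0 <=v u).
Hypothesis N_le : forall x, 0 <=v x -> N x <=v (C * `|x|) *: u.
Hypothesis L_reg : regular_op L.
Hypothesis L_T : op_le L (T s).
Hypothesis L_N : op_le L N.

(** On a piece [z] of [x] under a multiple of a hump, [L z] is below the image
    of that multiple, and these images are disjoint, and below the fixed vector
    on the right.  So the values on the pieces are dominated by disjoint
    vectors below it, whose sum is also below it. *)
Lemma minorant_le_humps (n m : nat) (eps t : R) x : (2 <= n)%N ->
  (forall r, `|hump a b e n r| <= eps) -> 0 <=v x ->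
  x <=v \sum_(i < n) m%:R *: hump a b e n (t + 2 * (pi / n%:R) * i%:R) ->
  L x <=v (C * (m%:R * eps)) *: u.
Proof.
move=> n2 beps x0; set d : R := pi / n%:R => xle.
pose B r := m%:R *: hump a b e n r.
have B0 r : 0 <=v B r by apply: vle_scale => //; exact: hump_ge0.
have [z zB ->] := riesz_decomposition_sum
  (y := fun i => B (t + 2 * d * i%:R)) x0 (fun i => B0 _) xle.
have eps0 : 0 <= eps by apply: le_trans (beps 0).
set v := _ *: u.
have v0 : 0 <=v v by apply: vle_scale => //; rewrite !mulr_ge0.
rewrite regular_op_sum//.
pose g (i : nat) := vmeet (B (t - al * s + 2 * d * i%:R)) v.
apply: (@vle_trans _ _ (\sum_(i < n) g i)).
  apply: vle_sum => i; have [zi0 ziB] := zB i; apply: vmeet_ge.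
    apply: (vle_trans (L_T zi0)).
    apply: (vle_trans (positive_op_mono (T_pos s0) ziB)).
    rewrite /B linearZ /= orbit_hump// addrAC; exact: vle_refl.
  apply: (vle_trans (L_N zi0)); apply: (vle_trans (N_le zi0)).
  apply: vleZr => //; apply: ler_wpM2l => //.
  apply: le_trans (vnorm_mono zi0 ziB) _.
  by rewrite normrZ ger0_norm//; apply: ler_wpM2l.
apply: disjoint_sum_le => //.
  by move=> i _; split; [exact: vmeet_ge0|exact: vmeet_ler].
move=> i j ij; apply: vle_anti; last by do 2 apply: vmeet_ge0 => //.
apply: (vle_trans (vmeet_mono (vmeet_lel _ _) (vmeet_lel _ _))).
by rewrite vmeetZ_eq0//; [exact: vle_refl|exact: hump_ge0..|exact: hump_disjoint].
Qed.

Lemma minorant_le0 x : 0 <=v x -> L x <=v 0.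
Proof.
have dominated (m : nat) y : 0 <=v y -> y <=v m%:R *: e -> L y <=v 0.
  move=> y0 ye; apply: vle_eps => d d0.
  pose c := 2 * (C * m%:R) * `|u| + 1.
  have c0 : 0 < c by rewrite ltr_wpDl// !mulr_ge0.
  have eps0 : 0 < d / c by rewrite divr_gt0.
  have [n n2 hn] := hump_norm_small eps0.
  have beps r : `|hump a b e n r| <= d / c by exact: ltW.
  pose S t := \sum_(i < n) m%:R *: hump a b e n (t + 2 * (pi / n%:R) * i%:R).
  have S0 t : 0 <=v S t.
    by apply: vsum_ge0 => i; apply: vle_scale => //; exact: hump_ge0.
  have yS : y <=v S 0 + S (pi / n%:R).
    apply: (vle_trans ye); rewrite /S -scaler_sumr -[X in _ + X]scaler_sumr -scalerDr.
    by apply: vleZ => //; exact: hump_cover.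
  have [y1 [y2 [-> [y10 y1S] [y20 y2S]]]] := riesz_decomposition y0 (S0 _) (S0 _) yS.
  exists ((2 * (C * (m%:R * (d / c)))) *: u).
    rewrite add0r regular_opD// mulr_natl mulr2n scalerDl; apply: vleD.
      exact: (minorant_le_humps n2 beps y10 y1S).
    exact: (minorant_le_humps n2 beps y20 y2S).
  rewrite normrZ ger0_norm; last first.
    by do 3 (apply: mulr_ge0 => //); exact: ltW.
  have -> : 2 * (C * (m%:R * (d / c))) * `|u| = (2 * (C * m%:R) * `|u|) * d / c.
    by ring.
  by rewrite ler_pdivrMr// mulrC ler_pM2l// lerDl.
move=> x0; apply: vle_eps => d d0.
have c0 : 0 < C * `|u| + 1 by rewrite ltr_wpDl// mulr_ge0.
have [m hm] := fixed_vector_quasi_interior T_C0 T_pos T_irr (modulus_ge0 e_lub)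
  modulus_neq0 modulus_fixed x0 (divr_gt0 d0 c0).
set r := vpos (x - m%:R *: e) in hm.
exists ((C * `|r|) *: u); last first.
  rewrite normrZ ger0_norm ?mulr_ge0// mulrAC.
  apply: le_trans (ler_wpM2l _ hm) _; first by rewrite mulr_ge0.
  by rewrite mulrA ler_pdivrMr// mulrC ler_pM2l// lerDl.
rewrite -(subrK r x) regular_opD//; apply: vleD.
  apply: (dominated m).
    by apply/vsub_ge0; apply: vpos_le => //; apply: vle_subl; apply: vle_scale => //;
      exact: (modulus_ge0 e_lub).
  by apply/vleBlD; rewrite addrC; apply/vleBlD; exact: vle_pos.
have r0 : 0 <=v r := vpos_ge0 _.
by apply: (vle_trans (L_N r0)); exact: N_le.
Qed.

End disjointness.

Lemma orbit_disjoint_finite_rank s (K : E -> E) :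
  0 <= s -> finite_rank K -> op_disjoint (T s) K.
Proof.
move=> s0 /finite_rank_dominated[k [C [u [-> C0 u0 kC]]]].
have kbd x y : 0 <=v x -> vabs y <=v x -> k y <=v (C * `|x|) *: u.
  move=> x0 yx; apply: (vle_trans (kC y)); apply: vleZr => //.
  by apply: ler_wpM2l => //; exact: vnorm_le_abs.
have kb x : 0 <=v x -> exists z, forall y, vabs y <=v x -> k y <=v z.
  by move=> x0; exists ((C * `|x|) *: u) => y; exact: kbd.
have [N Nmod Nle] := riesz_kantorovich ocn kb.
exists (T s), N; split=> //; first exact/positive_op_modulus/T_pos.
have N_le x : 0 <=v x -> N x <=v (C * `|x|) *: u.
  by move=> x0; apply: Nle => // y; exact: kbd.
have N0 : positive_op N.
  have [_ Nub _] := Nmod; move=> x x0; apply: (vle_trans (vabs_ge0 (k x))).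
  by apply: vabs_le; [apply: (Nub k) => //; left|apply: (Nub (fun x => - k x)) => //; right].
split.
- exists \0, \0; split=> [x _|x _|x]; rewrite ?subr0//; exact: vle_refl.
- by move=> _ [->|->] x x0; [exact: T_pos|exact: N0].
- move=> L Lreg Lub x x0; apply: (@minorant_le0 s C u N L) => //.
  + by apply: Lub; left.
  + by apply: Lub; right.
Qed.

End peripheral_eigenvalue.

Theorem proposition3p2 (R : realType) (E : banachLatticeType R)
    (hE : order_continuous_norm E) (T : R -> {linear E -> E})
    (hT : C0_semigroup T) (hpos : positive_semigroup T)
    (hirr : irreducible_semigroup T)
    (hAbel : Abel_bounded (complexify (generator T)))
    (t0 : R) (ht0 : 0 < t0) (hharris : harris (T t0)) :
  point_spectrum (complexify (generator T)) `&` [set l | complex.Re l = 0]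
    `<=` [set 0].
Proof.
move=> [re al] [[[a b] [[/= da db] z0 zE]] /= re0]; subst re.
apply: contrapT => l0.
have al0 : al != 0 by apply/eqP => al0; apply: l0; rewrite al0.
have [Aa Ab] : generator T a = - al *: b /\ generator T b = al *: a.
  have : (generator T a, generator T b) = (0 *: a - al *: b, 0 *: b + al *: a).
    exact: zE.
  by rewrite !scale0r sub0r add0r scaleNr => -[].
have ab0 : a != 0 \/ b != 0.
  apply/orP; rewrite -negb_and; apply: contraNN z0 => /andP[/eqP -> /eqP ->].
  by [].
have [e e_lub] := modulus_exists hE a b.
have [f [M [f0 fT M0 fM fs]]] :=
  invariant_functional hT hpos hirr hAbel da db Aa Ab ab0 e_lub.
have [_ [n n0]] := hharris; apply.
have iterE x : iter n (T t0) x = T (n%:R * t0) x.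
  elim: n {n0} => [|n IH]; first by rewrite mul0r; case: hT => _ -> _ _.
  rewrite iterS IH -natr1 mulrDl mul1r addrC (semigroupD hT)//; first exact: ltW.
  by rewrite mulr_ge0// ltW.
have s0 : 0 <= n%:R * t0 by rewrite mulr_ge0// ltW.
rewrite (_ : iter n (T t0) = T (n%:R * t0)); last exact: funext.
split; first exact/positive_op_regular/hpos.
move=> K; exact: (orbit_disjoint_finite_rank hE hT hpos hirr da db Aa Ab al0 ab0
  e_lub f0 fT M0 fM fs).
Qed.
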